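(* Let $A$ be a Reedy finite dimensional $k$-algebra with idempotents $e_0,\dots,e_n$, degree function $\deg\colon\{e_0,\dots,e_n\}\to\mathbb{N}$ and subalgebras $A^+,A^-$. Order the simple modules $L(0),\dots,L(n)$ of $A$ by setting $L(i)\lhd L(j)$ if and only if $\deg(e_i)>\deg(e_j)$. Then $(A,\unlhd)$ is a quasi-hereditary algebra and $A^-$ is an exact Borel subalgebra of $A$.
   Context: $k$ is a field. All modules are left modules. A finite dimensional $k$-algebra $A$ with a complete set of orthogonal idempotents $\{e_0,\dots,e_n\}$ (not necessarily primitive) is called Reedy if there are a function $\deg\colon\{e_0,\dots,e_n\}\to\mathbb{N}$ and subalgebras $A^+,A^-$ of $A$ containing $e_0,\dots,e_n$ such that: $e_iA^+e_i\cong k$ for all $i$, and for $i\ne j$, $e_jA^+e_i\neq0$ implies $\deg(e_j)>\deg(e_i)$; $e_iA^-e_i\cong k$ for all $i$, and for $i\neq j$, $e_jA^-e_i\ne0$ implies $\deg(e_j)<\deg(e_i)$; and for all $i,j$ multiplication in $A$ induces an isomorphism of $k$-vector spaces $\bigoplus_{l=0}^n e_jA^+e_l\otimes_k e_lA^-e_i\cong e_jAe_i$. Indexing of the simples. For modules $P,M$, $\operatorname{Tr}_PM$ is the submodule of $M$ generated by the images of all homomorphisms $P\to M$. For each $i$, the $A$-module $Ae_i/\sum_{\deg(e_j)<\deg(e_i)}\operatorname{Tr}_{Ae_j}Ae_i$ has a unique simple quotient, denoted $L(i)$; the modules $L(0),\dots,L(n)$ are pairwise non-isomorphic and represent all isomorphism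 classes of simple $A$-modules. Similarly (applying this to the Reedy algebra $A^-$), the simple $A^-$-modules are indexed as $S(0),\dots,S(n)$, where $S(i)$ is the unique simple quotient of $A^-e_i$. The order $\unlhd$ is regarded as a partial order on $\Lambda=\{0,\dots,n\}$ ($i\unlhd j$ iff $i=j$ or $i\lhd j$). Quasi-hereditary algebras. Let $A$ be a finite dimensional $k$-algebra whose simple modules up to isomorphism are $L(i)$, $i\in\Lambda$, with projective covers $P(i)$, and let $\unlhd$ be a partial order on the finite set $\Lambda$. The standard module $\Delta(i)$ is the largest quotient of $P(i)$ all of whose composition factors are of the form $L(j)$ with $j\unlhd i$. Then $(A,\unlhd)$ is quasi-hereditary if for all $i\in\Lambda$: (i) the kernel of the canonical surjection $\Delta(i)\to L(i)$ has a finite filtration with all subquotients isomorphic to some $L(j)$ with $j\lhd i$; (ii) the kernel of the natural surjection $P(i)\to\Delta(i)$ has a finite filtration with all subquotients isomorphic to some $\Delta(j)$ with $j\rhd i$. Exact Borel subalgebras. Let $(A,\unlhd)$ be quasi-hereditary and let $B$ be a subalgebra of $A$ having the same number of simple modules as $A$, denoted $S(i)$, $i\in\Lambda$. Then $B$ is an exact Borel subalgebra of $A$ if: (i) $(B,\unlhd)$ is quasi-hereditary with simple standard modules; (ii) the induction functor $A\otimes_B-$ from $B$-modules to $A$-modules is exact; (iii) for each $i\in\Lambda$ there is an isomorphism $\Delta(i)\cong A\otimes_BS(i)$ of $A$-modules. *)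

(* Defs.v *)
From HB Require Import structures.
From mathcomp Require Import all_boot all_order all_algebra all_field.
From mathcomp Require Import boolp classical_sets.

Set Implicit Arguments.
Unset Strict Implicit.
Unset Printing Implicit Defensive.

Import GRing.Theory.

Local Open Scope ring_scope.
Local Open Scope classical_set_scope.
Local Open Scope quotient_scope.

(* Left R-modules are [lmodType R], with no finiteness condition.  Subsets are *)
(* classical ([set M := M -> Prop]); the boolean membership predicates that    *)
(* MathComp's algebra needs are obtained through [asbool].                     *)

Record submodule (R : nzRingType) (M : lmodType R) := Submodule {
  sm_set :> M -> Prop;
  sm_closed : submod_closed [in (sm_set : set M)]
}.

Definition sm_pred (R : nzRingType) (M : lmodType R) (U : submodule M) :
  {pred M} := [in (sm_set U : set M)].

HB.instance Definition _ (R : nzRingType) (M : lmodType R) (U : submodule M) :=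
  GRing.isSubmodClosed.Build R M (sm_pred U) (sm_closed U).

Lemma sm_predE (R : nzRingType) (M : lmodType R) (U : submodule M) (x : M) :
  (x \in sm_pred U) = `[< sm_set U x >].
Proof. by []. Qed.

Lemma submoduleP (R : nzRingType) (M : lmodType R) (U : set M) :
  U 0 -> (forall (a : R) x y, U x -> U y -> U (a *: x + y)) ->
  submod_closed [in U].
Proof.
move=> U0 Ulin; split; first by apply/asboolP.
by move=> a x y /asboolP Ux /asboolP Uy; apply/asboolP; exact: Ulin.
Qed.

Lemma submodule0 (R : nzRingType) (M : lmodType R) (U : submodule M) : U 0.
Proof. by have [/asboolP] := sm_closed U. Qed.

Lemma submoduleD (R : nzRingType) (M : lmodType R) (U : submodule M)
  (a : R) (x y : M) : U x -> U y -> U (a *: x + y).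
Proof.
by move=> /asboolP Ux /asboolP Uy; have [_ /(_ a x y Ux Uy)/asboolP] := sm_closed U.
Qed.

Record submod (R : nzRingType) (M : lmodType R) (U : submodule M) := Submod {
  submod_val : M;
  submod_valP : submod_val \in sm_pred U
}.

Section SubmodInstances.
Variables (R : nzRingType) (M : lmodType R) (U : submodule M).
HB.instance Definition _ := [isSub of submod U for @submod_val R M U].
HB.instance Definition _ := [Choice of submod U by <:].
HB.instance Definition _ :=
  GRing.SubChoice_isSubLmodule.Build R M (sm_pred U) (submod U)
    (GRing.subsemimodClosedP _).
End SubmodInstances.

Definition quotmod (R : nzRingType) (M : lmodType R) (U : submodule M) :=
  Quotient.quot (sm_pred U).

Section QuotmodInstances.
Variables (R : nzRingType) (M : lmodType R) (U : submodule M).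
HB.instance Definition _ := GRing.Zmodule.on (quotmod U).

Definition quotmod_pi (x : M) : quotmod U :=
  \pi_(Quotient.quot (sm_pred U)) x.
Definition quotmod_repr (x : quotmod U) : M :=
  @repr _ (Quotient.quot (sm_pred U)) x.

Lemma quotmod_reprK : cancel quotmod_repr quotmod_pi.
Proof. exact: reprK. Qed.

Lemma quotmod_piE (x y : M) : quotmod_pi x = quotmod_pi y <-> U (x - y).
Proof.
split=> [/eqP|Uxy]; last apply/eqP.
  by rewrite -Quotient.idealrBE => /asboolP.
by rewrite -Quotient.idealrBE; apply/asboolP.
Qed.

Lemma quotmod_piD : {morph quotmod_pi : x y / x + y}.
Proof. by move=> x y; rewrite /quotmod_pi [LHS]Quotient.pi_add. Qed.

Definition quotmod_scale (a : R) (x : quotmod U) : quotmod U :=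
  quotmod_pi (a *: quotmod_repr x).

Lemma quotmod_piZ (a : R) (x : M) :
  quotmod_pi (a *: x) = quotmod_scale a (quotmod_pi x).
Proof.
apply/quotmod_piE; rewrite -scalerBr -[_ *: _]addr0.
by apply: submoduleD (submodule0 U); apply/quotmod_piE; rewrite quotmod_reprK.
Qed.

Fact quotmod_scaleA a b x :
  quotmod_scale a (quotmod_scale b x) = quotmod_scale (a * b) x.
Proof. by rewrite -[x]quotmod_reprK -!quotmod_piZ scalerA. Qed.
Fact quotmod_scale1 : left_id 1 quotmod_scale.
Proof. by move=> x; rewrite -[x]quotmod_reprK -!quotmod_piZ scale1r. Qed.
Fact quotmod_scaleDr : right_distributive quotmod_scale +%R.
Proof.
move=> a x y; rewrite -[x]quotmod_reprK -[y]quotmod_reprK.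
by rewrite -quotmod_piD -!quotmod_piZ -quotmod_piD scalerDr.
Qed.
Fact quotmod_scaleDl x : {morph quotmod_scale^~ x : a b / a + b}.
Proof.
by move=> a b; rewrite -[x]quotmod_reprK -!quotmod_piZ -quotmod_piD scalerDl.
Qed.
HB.instance Definition _ := GRing.Zmodule_isLmodule.Build R (quotmod U)
  quotmod_scaleA quotmod_scale1 quotmod_scaleDr quotmod_scaleDl.

Fact quotmod_pi_is_linear : linear quotmod_pi.
Proof. by move=> a x y; rewrite quotmod_piD quotmod_piZ. Qed.
HB.instance Definition _ :=
  GRing.isLinear.Build R M (quotmod U) _ quotmod_pi quotmod_pi_is_linear.
End QuotmodInstances.

Section SubmoduleConstructions.
Variables (R : nzRingType) (M : lmodType R).

Definition gen_set (X : set M) : set M :=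
  [set x | forall U : submodule M, X `<=` U -> U x].
Fact gen_closed (X : set M) : submod_closed [in gen_set X].
Proof.
apply: submoduleP => [U _|a x y Hx Hy U XU]; first exact: submodule0.
by apply: submoduleD; [exact: Hx | exact: Hy].
Qed.
Definition gen (X : set M) : submodule M := Submodule (gen_closed X).

Definition ker_set (N : lmodType R) (f : {linear M -> N}) : set M :=
  [set x | f x = 0].
Fact ker_closed (N : lmodType R) (f : {linear M -> N}) :
  submod_closed [in ker_set f].
Proof.
apply: submoduleP => [|a x y fx fy]; rewrite /ker_set /=; first exact: linear0.
by rewrite linearP fx fy scaler0 addr0.
Qed.
Definition ker (N : lmodType R) (f : {linear M -> N}) : submodule M :=
  Submodule (ker_closed f).

Definition restr_set (V U : submodule M) : set (submod V) :=
  [set x | U (val x)].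
Fact restr_closed (V U : submodule M) : submod_closed [in @restr_set V U].
Proof.
apply: submoduleP => [|a x y Ux Uy]; rewrite /restr_set /=.
  exact: submodule0.
exact: submoduleD.
Qed.
Definition restr (V U : submodule M) : submodule (submod V) :=
  Submodule (restr_closed V U).

(* V / U when U is contained in V; in general V / (V :&: U). *)
Definition subquot (V U : submodule M) : lmodType R := quotmod (restr V U).

End SubmoduleConstructions.

Section LeftIdeal.
Variables (R : nzRingType) (x : R).
Definition lideal_set : set R^o := [set y | exists a : R, y = a * x].
Fact lideal_closed : submod_closed [in lideal_set].
Proof.
apply: submoduleP => [|a _ _ [b ->] [c ->]]; first by exists 0; rewrite mul0r.
by exists (a * b + c); rewrite mulrDl -mulrA.
Qed.
Definition lideal : submodule R^o := Submodule lideal_closed.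
End LeftIdeal.

(* X is a right R-module through [ract], N is a left R-module.  Elements of    *)
(* the tensor product are represented by formal sums of pure tensors, i.e.     *)
(* lists of pairs, and two formal sums are identified when no balanced map     *)
(* separates them.  This is the usual construction: the relations imposed are  *)
(* those that hold in every abelian group receiving a balanced map.            *)
Section Tensor.
Variables (R : nzRingType) (X : zmodType) (ract : X -> R -> X).
Variable N : lmodType R.

Definition balanced (V : zmodType) (phi : X -> N -> V) : Prop :=
  [/\ forall x y n, phi (x + y) n = phi x n + phi y n,
      forall x m n, phi x (m + n) = phi x m + phi x n
    & forall x r n, phi (ract x r) n = phi x (r *: n)].

Definition sum_tens (V : zmodType) (phi : X -> N -> V) (s : seq (X * N)) : V :=
  \sum_(p <- s) phi p.1 p.2.

Definition tensor_eq : rel (seq (X * N)) := fun s t =>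
  `[< forall (V : zmodType) (phi : X -> N -> V),
        balanced phi -> sum_tens phi s = sum_tens phi t >].

Fact tensor_eq_equiv : equiv_class_of tensor_eq.
Proof.
split=> [s|s t|t s u].
- exact/asboolP.
- by apply/asboolP/asboolP => st V phi /st.
- move=> /asboolP st /asboolP tu; apply/asboolP => V phi b.
  by rewrite (st _ _ b) (tu _ _ b).
Qed.
Canonical tensor_equiv := EquivRelPack tensor_eq_equiv.
Canonical tensor_encModRel := defaultEncModRel tensor_eq.

Definition tensor := {eq_quot tensor_eq}.
HB.instance Definition _ : EqQuotient _ tensor_eq tensor :=
  EqQuotient.on tensor.
HB.instance Definition _ := Choice.on tensor.

Definition tensor_pi (s : seq (X * N)) : tensor := \pi_tensor s.

Lemma tensor_piP s t : tensor_pi s = tensor_pi t <->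
  forall (V : zmodType) (phi : X -> N -> V),
    balanced phi -> sum_tens phi s = sum_tens phi t.
Proof.
split=> [/eqP|st]; last by apply/eqP; rewrite piE; apply/asboolP.
by rewrite piE => /asboolP.
Qed.

Definition tensor_lift (V : zmodType) (phi : X -> N -> V) (t : tensor) : V :=
  sum_tens phi (repr t).

Lemma tensor_lift_pi (V : zmodType) (phi : X -> N -> V) s :
  balanced phi -> tensor_lift phi (tensor_pi s) = sum_tens phi s.
Proof. by move=> b; move: V phi b; apply/tensor_piP; rewrite /tensor_pi reprK. Qed.

Lemma balanced0l (V : zmodType) (phi : X -> N -> V) n :
  balanced phi -> phi 0 n = 0.
Proof.
by case=> D _ _; apply: (addrI (phi 0 n)); rewrite -D !addr0.
Qed.

Lemma balancedNl (V : zmodType) (phi : X -> N -> V) x n :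
  balanced phi -> phi (- x) n = - phi x n.
Proof.
move=> b; have [D _ _] := b; apply: (addrI (phi x n)).
by rewrite -D !subrr balanced0l.
Qed.

Definition tensor_zero : tensor := tensor_pi [::].
Definition tensor_add (t u : tensor) : tensor := tensor_pi (repr t ++ repr u).
Definition tensor_opp (t : tensor) : tensor :=
  tensor_pi [seq (- p.1, p.2) | p <- repr t].

Lemma sum_tens_cat (V : zmodType) (phi : X -> N -> V) s t :
  sum_tens phi (s ++ t) = sum_tens phi s + sum_tens phi t.
Proof. by rewrite /sum_tens big_cat. Qed.

Lemma sum_tens_opp (V : zmodType) (phi : X -> N -> V) s : balanced phi ->
  sum_tens phi [seq (- p.1, p.2) | p <- s] = - sum_tens phi s.
Proof.
move=> b; rewrite /sum_tens big_map -sumrN; apply: eq_bigr => p _ /=.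
exact: balancedNl.
Qed.

Lemma sum_tens_repr (V : zmodType) (phi : X -> N -> V) s :
  balanced phi -> sum_tens phi (repr (tensor_pi s)) = sum_tens phi s.
Proof. exact: tensor_lift_pi. Qed.

Lemma tensor_repr (t : tensor) : t = tensor_pi (repr t).
Proof. by rewrite /tensor_pi reprK. Qed.

Fact tensor_addA : associative tensor_add.
Proof.
move=> t u v; apply/tensor_piP => V phi b.
by rewrite !(sum_tens_cat, sum_tens_repr _ b) addrA.
Qed.
Fact tensor_addC : commutative tensor_add.
Proof.
by move=> t u; apply/tensor_piP => V phi b; rewrite !sum_tens_cat addrC.
Qed.
Fact tensor_add0 : left_id tensor_zero tensor_add.
Proof.
move=> t; rewrite [RHS]tensor_repr; apply/tensor_piP => V phi b.
by rewrite sum_tens_cat sum_tens_repr // /sum_tens big_nil add0r.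
Qed.
Fact tensor_addN : left_inverse tensor_zero tensor_opp tensor_add.
Proof.
move=> t; apply/tensor_piP => V phi b.
by rewrite sum_tens_cat sum_tens_repr // sum_tens_opp // addNr /sum_tens big_nil.
Qed.
HB.instance Definition _ := GRing.isZmodule.Build tensor
  tensor_addA tensor_addC tensor_add0 tensor_addN.

Definition tens (x : X) (n : N) : tensor := tensor_pi [:: (x, n)].

Lemma tensor_piE s : tensor_pi s = sum_tens tens s.
Proof.
have cat2 s1 s2 : tensor_pi (s1 ++ s2) = tensor_pi s1 + tensor_pi s2.
  apply/tensor_piP => V phi b.
  by rewrite !sum_tens_cat !sum_tens_repr.
elim: s => [|[x n] s IHs]; first by rewrite /sum_tens big_nil.
by rewrite -cat1s cat2 IHs sum_tens_cat [sum_tens _ [:: _]]big_seq1.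
Qed.

Lemma tens_balanced : balanced tens.
Proof.
have E x n (V : zmodType) (phi : X -> N -> V) : sum_tens phi [:: (x, n)] = phi x n.
  by rewrite /sum_tens big_seq1.
split=> [x y n|x m n|x r n]; apply/tensor_piP => V phi b;
  by rewrite ?(sum_tens_cat, sum_tens_repr _ b) !E; have [] := b.
Qed.

Lemma tensor_liftE (V : zmodType) (phi : X -> N -> V) x n :
  balanced phi -> tensor_lift phi (tens x n) = phi x n.
Proof. by move=> b; rewrite tensor_lift_pi // /sum_tens big_seq1. Qed.

Lemma tensor_liftD (V : zmodType) (phi : X -> N -> V) :
  balanced phi -> {morph tensor_lift phi : t u / t + u}.
Proof. by move=> b t u; rewrite [LHS]tensor_lift_pi // sum_tens_cat. Qed.

(* Pure tensors generate, hence the map induced by a balanced map is unique. *)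
Lemma tensor_ind (P : tensor -> Prop) :
  (forall x n, P (tens x n)) -> P 0 -> (forall t u, P t -> P u -> P (t + u)) ->
  forall t, P t.
Proof.
move=> Pt P0 PD t; rewrite [t]tensor_repr tensor_piE /sum_tens.
by apply: big_ind => // p _; exact: Pt.
Qed.

End Tensor.

Section Induction.
Variables (k : fieldType) (A : falgType k) (B : {aspace A}).

Definition right_mul (a : A) (b : subvs_of B) : A := a * vsval b.

Definition induct (N : lmodType (subvs_of B)) := tensor right_mul N.

Section InductModule.
Variable N : lmodType (subvs_of B).
HB.instance Definition _ := GRing.Zmodule.on (induct N).

Definition induct_scale (a : A) : induct N -> induct N :=
  tensor_lift (fun x n => tens right_mul (a * x) n).

Fact induct_scale_balanced (a : A) :
  balanced right_mul (fun x (n : N) => tens right_mul (a * x) n).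
Proof.
have [Dl Dr Z] := tens_balanced right_mul N.
split=> [x y n|x m n|x r n]; first by rewrite mulrDr Dl.
  exact: Dr.
by rewrite -Z /right_mul mulrA.
Qed.

Lemma induct_scaleE a x (n : N) :
  induct_scale a (tens right_mul x n) = tens right_mul (a * x) n.
Proof. exact: tensor_liftE (induct_scale_balanced a). Qed.

Fact induct_scaleDr : right_distributive induct_scale +%R.
Proof. by move=> a; exact: tensor_liftD (induct_scale_balanced a). Qed.
Fact induct_scale0 a : induct_scale a 0 = 0.
Proof. by apply: (addrI (induct_scale a 0)); rewrite -induct_scaleDr !addr0. Qed.
Fact induct_scaleA a b t :
  induct_scale a (induct_scale b t) = induct_scale (a * b) t.
Proof.
elim/tensor_ind: t => [x n||t u IHt IHu]; last by rewrite !induct_scaleDr IHt IHu.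
  by rewrite !induct_scaleE mulrA.
by rewrite !induct_scale0.
Qed.
Fact induct_scale1 : left_id 1 induct_scale.
Proof.
elim/tensor_ind=> [x n||t u IHt IHu]; last by rewrite induct_scaleDr IHt IHu.
  by rewrite induct_scaleE mul1r.
exact: induct_scale0.
Qed.
Fact induct_scaleDl t : {morph induct_scale^~ t : a b / a + b}.
Proof.
move=> a b; elim/tensor_ind: t => [x n||t u IHt IHu].
- have [Dl _ _] := tens_balanced right_mul N.
  by rewrite /= !induct_scaleE mulrDl Dl.
- by rewrite /= !induct_scale0 addr0.
- by rewrite /= !induct_scaleDr IHt IHu addrACA.
Qed.
HB.instance Definition _ := GRing.Zmodule_isLmodule.Build A (induct N)
  induct_scaleA induct_scale1 induct_scaleDr induct_scaleDl.
End InductModule.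

Section InductMap.
Variables (M N : lmodType (subvs_of B)) (f : {linear M -> N}).

Definition induct_map : induct M -> induct N :=
  tensor_lift (fun x n => tens right_mul x (f n)).

Fact induct_map_balanced :
  balanced right_mul (fun x (n : M) => tens right_mul x (f n)).
Proof.
have [Dl Dr Z] := tens_balanced right_mul N.
split=> [x y n|x m n|x r n]; first exact: Dl.
  by rewrite linearD Dr.
by rewrite linearZ Z.
Qed.

Lemma induct_mapE x n :
  induct_map (tens right_mul x n) = tens right_mul x (f n).
Proof. exact: tensor_liftE induct_map_balanced. Qed.

Fact induct_map_is_linear : linear induct_map.
Proof.
have D := tensor_liftD induct_map_balanced.
have m0 : induct_map 0 = 0.
  by apply: (addrI (induct_map 0)); rewrite -D !addr0.
move=> a t u; rewrite [LHS]D; congr (_ + _).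
elim/tensor_ind: t => [x n||t v IHt IHv].
- transitivity (induct_map (tens right_mul (a * x) n)).
    by congr induct_map; exact: induct_scaleE.
  by rewrite !induct_mapE; symmetry; exact: induct_scaleE.
- by rewrite scaler0 [LHS]m0 m0 scaler0.
- by rewrite scalerDr [LHS]D IHt IHv [X in _ = a *: X]D scalerDr.
Qed.
HB.instance Definition _ := GRing.isLinear.Build A (induct M) (induct N) _
  induct_map induct_map_is_linear.
End InductMap.

End Induction.

Definition surj (T U : Type) (f : T -> U) : Prop := forall y, exists x, f x = y.

Section ModuleTheory.
Variable R : nzRingType.
Implicit Types M N P : lmodType R.

Definition lmod_iso M N : Prop := exists f : {linear M -> N}, bijective f.

Definition short_exact M' M M'' (f : {linear M' -> M}) (g : {linear M -> M''}) :=
  [/\ injective f, surj g & forall x, g x = 0 <-> exists y, f y = x].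

Definition simple M : Prop :=
  (exists x : M, x <> 0) /\
  forall U : submodule M, (forall x, U x -> x = 0) \/ (forall x, U x).

Definition projective P : Prop :=
  forall M N (g : {linear M -> N}) (f : {linear P -> N}), surj g ->
    exists h : {linear P -> M}, forall x, g (h x) = f x.

(* The last clause says that the kernel of p is a superfluous submodule of P. *)
Definition projective_cover P M (p : {linear P -> M}) : Prop :=
  [/\ projective P, surj p
    & forall U : submodule P,
        (forall x, exists u v, [/\ U u, p v = 0 & x = u + v]) -> forall x, U x].

Definition filtration (C : lmodType R -> Prop) M m (F : nat -> submodule M) :=
  [/\ forall x, F 0%N x <-> x = 0,
      forall x, F m x,
      forall t, (t < m)%N -> forall x, F t x -> F t.+1 x
    & forall t, (t < m)%N -> C (subquot (F t.+1) (F t))].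

Definition filtered (C : lmodType R -> Prop) M : Prop :=
  exists m (F : nat -> submodule M), filtration C m F.

(* Meant for modules of finite length only: other modules have no composition  *)
(* series, hence no composition factors in this sense.                         *)
Definition composition_factor M X : Prop :=
  exists m (F : nat -> submodule M), filtration simple m F /\
    exists2 t, (t < m)%N & lmod_iso (subquot (F t.+1) (F t)) X.

Definition trace P M : submodule M :=
  gen [set y | exists (f : {linear P -> M}) x, y = f x].

Definition complete_simples (I : Type) (L : I -> lmodType R) : Prop :=
  [/\ forall i, simple (L i),
      forall i j, lmod_iso (L i) (L j) -> i = j
    & forall X, simple X -> exists i, lmod_iso X (L i)].

Section Standard.
Variables (I : finType) (L : I -> lmodType R) (le : rel I).

Definition factors_below i X : Prop :=
  forall Y, composition_factor X Y -> exists2 j, le j i & lmod_iso Y (L j).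

(* p is a projective cover of L i, and q is the projection of P onto its       *)
(* largest quotient all of whose composition factors are L j with j <= i.      *)
Definition standard_data i (P D : lmodType R)
    (p : {linear P -> L i}) (q : {linear P -> D}) : Prop :=
  [/\ projective_cover p, surj q, factors_below i D
    & forall U : submodule P, factors_below i (quotmod U) ->
        forall x, q x = 0 -> U x].

Definition standard_module i (D : lmodType R) : Prop :=
  exists (P : lmodType R) (p : {linear P -> L i}) (q : {linear P -> D}),
    standard_data p q.

End Standard.
End ModuleTheory.

Section QuasiHereditary.
Variables (k : fieldType) (A : falgType k) (I : finType).

(* r i is the canonical surjection Delta(i) -> L(i), determined by r i \o q i  *)
(* = p i.                                                                      *)
Definition quasi_hereditary (L : I -> lmodType A) (le : rel I) : Prop :=
  [/\ reflexive le, antisymmetric le, transitive le, complete_simples L &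
      exists (P D : I -> lmodType A) (p : forall i, {linear P i -> L i})
             (q : forall i, {linear P i -> D i})
             (r : forall i, {linear D i -> L i}),
      forall i,
      [/\ standard_data le (p i) (q i),
          forall x, r i (q i x) = p i x,
          filtered (fun X => exists2 j, le j i && (j != i) & lmod_iso X (L j))
                   (submod (ker (r i)))
        & filtered (fun X => exists2 j, le i j && (i != j) & lmod_iso X (D j))
                   (submod (ker (q i)))]].

End QuasiHereditary.

Section ExactBorel.
Variables (k : fieldType) (A : falgType k) (I : finType).

Definition exact_induction (B : {aspace A}) : Prop :=
  forall (N' N N'' : lmodType (subvs_of B))
         (f : {linear N' -> N}) (g : {linear N -> N''}),
    short_exact f g -> short_exact (induct_map f) (induct_map g).

(* [{aspace A}] allows B to have a unit other than that of A, hence [1 \in B]. *)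
Definition exact_borel (L : I -> lmodType A) (le : rel I) (B : {aspace A})
    (S : I -> lmodType (subvs_of B)) : Prop :=
  [/\ 1 \in B,
      quasi_hereditary S le,
      forall i D, standard_module S le i D -> simple D,
      exact_induction B
    & forall i D, standard_module L le i D -> lmod_iso D (induct (S i))].

End ExactBorel.

Section Reedy.
Variables (k : fieldType) (A : falgType k) (n : nat).
Variables (e : 'I_n.+1 -> A) (deg : 'I_n.+1 -> nat).

(* x U y: [amull x] is v |-> x * v and [amulr y] is v |-> v * y. *)
Definition peirce (x : A) (U : {vspace A}) (y : A) : {vspace A} :=
  ((amulr y \o amull x) @: U)%VS.

Variables (Ap Am : {aspace A}).

Definition reedy_tensor (j i l : 'I_n.+1) :=
  tensor (fun (x : subvs_of (peirce (e j) Ap (e l))) (c : k) => c *: x)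
         (subvs_of (peirce (e l) Am (e i))).

(* The map induced by multiplication on the direct sum over l, an element of   *)
(* the (finite) direct sum being the family t of its components.               *)
Definition reedy_mul (j i : 'I_n.+1) (t : forall l, reedy_tensor j i l) : A :=
  \sum_l tensor_lift (fun x y => vsval x * vsval y) (t l).

(* [deg i] is the degree of [e i]; the conditions force the [e i] to be        *)
(* nonzero, hence distinct, so this is a function on {e_0, ..., e_n}.  A       *)
(* one-dimensional corner e_i U e_i is isomorphic to k.                        *)
Record reedy : Prop := Reedy {
  reedy_orthogonal : forall i j, e i * e j = if i == j then e i else 0;
  reedy_complete : \sum_i e i = 1;
  reedy_memp : forall i, e i \in Ap;
  reedy_memm : forall i, e i \in Am;
  reedy_diagp : forall i, \dim (peirce (e i) Ap (e i)) = 1%N;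
  reedy_degp : forall i j, i != j ->
    peirce (e j) Ap (e i) != 0%VS -> (deg i < deg j)%N;
  reedy_diagm : forall i, \dim (peirce (e i) Am (e i)) = 1%N;
  reedy_degm : forall i j, i != j ->
    peirce (e j) Am (e i) != 0%VS -> (deg j < deg i)%N;
  reedy_mul_inj : forall i j, injective (@reedy_mul j i);
  reedy_mul_im : forall i j (a : A),
    a \in peirce (e j) fullv (e i) <-> exists t, @reedy_mul j i t = a
}.

Definition proj_mod (i : 'I_n.+1) : lmodType A := submod (lideal (e i)).

Definition lower_trace (i : 'I_n.+1) : submodule (proj_mod i) :=
  gen (\bigcup_(j in [set j | (deg j < deg i)%N])
         (trace (proj_mod j) (proj_mod i) : set (proj_mod i))).

(* L(i) is the X, unique up to isomorphism, that satisfies this. *)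
Definition reedy_simple (i : 'I_n.+1) (X : lmodType A) : Prop :=
  simple X /\ exists q : {linear quotmod (lower_trace i) -> X}, surj q.

Definition reedy_minus_simple (i : 'I_n.+1) (X : lmodType (subvs_of Am)) : Prop :=
  simple X /\
  exists q : {linear submod (lideal (vsproj Am (e i))) -> X}, surj q.

Definition reedy_le : rel 'I_n.+1 := fun i j => (i == j) || (deg j < deg i)%N.

End Reedy.

(* Main.v *)
Require Import Defs.
From HB Require Import structures.
From mathcomp Require Import all_boot all_order all_algebra all_field.
From mathcomp Require Import boolp classical_sets.

(* Let A_{<d} be the ideal generated by the e_j with deg e_j < d.  Mixed terms *)
(* e_l A^- A^+ e_m can be rewritten in A^+ A^- through idempotents of smaller  *)
(* degree, so A_{<d} is the sum of the A^+ e_l A^- with deg e_l < d, and        *)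
(* A_{<=d} / A_{<d} is the direct sum over deg e_l = d of the bimodules         *)
(* Delta(l) (x) e_l A / e_l A_{<d}, where Delta(l) = A e_l / A_{<deg e_l} e_l  *)
(* restricts to A^+ e_l.  Multiplying on the right by an idempotent eps of      *)
(* e_i A e_i with A eps the projective cover of L(i), one gets a filtration of *)
(* A eps with top Delta(i) and the other subquotients Delta(l), l |> i.        *)
(* The argument only uses this heredity property, which A^- inherits           *)
(* with the span of the e_i in the role of A^+; there Delta(i) is simple.  As  *)
(* a right A^- module A is the sum of the A^+ e_l (x) e_l A^-, hence has a     *)
(* finite dual basis; this gives exactness of induction, and Delta(i) is       *)
(* A (x) S(i) since both are A^+ e_i.                                          *)

Set Implicit Arguments.
Unset Strict Implicit.
Unset Printing Implicit Defensive.

Import GRing.Theory.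

Local Open Scope ring_scope.
Local Open Scope classical_set_scope.

(** * Modules, filtrations and uniqueness of standard modules *)

(** Write [A_{<d}] for the ideal generated by the [e_j] of degree below [d]. Small degree means high
    in the order, so the successive quotients of these ideals should be built from standard modules.
    The degree conditions allow every element of [A_{<d}] to be straightened into a sum of terms
    [x e_l y] with [x] in [A^+], [y] in [A^-] and [deg l < d] ([trace_ideal_split]), and they reduce
    [A e_l] to [A^+ e_l] modulo lower degrees ([plus_reduce]). Since such decompositions are unique
    as tensors, no relations occur in a layer beyond those of [Delta(l)] and of [e_l A] modulo the
    ideal. The record [heredity] isolates this; [reedy_heredity] proves it.

    Quasi-heredity follows from [heredity] alone ([heredity_quasi_hereditary]). Each corner
    [e_i A e_i] reduces to scalars modulo [A_{<deg i}], so a simple module is determined by the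
    idempotent of least degree that does not kill it ([highest_weight_unique]). As [e_i] need not be
    primitive, the projective cover of [L(i)] is [A eps] for a minimal idempotent [eps] of
    [e_i A e_i] ([standard_exists]), and intersecting [A eps] with the [A_{<d}] filters the kernel
    of [A eps -> Delta(i)] by standard modules ([layer_fil]).

    For the Borel part, [A^-] satisfies [heredity] as well ([minus_heredity]), and its standard
    modules are the simples [S(i)] ([minus_Delta_simple]). A basis of each [A^+ e_l] gives a finite
    dual basis of [A] as a right [A^-]-module ([minus_dual_basis]), which makes induction exact;
    comparing annihilators of generators identifies [Delta(i)] with the induced module
    ([Delta_induct]). *)

Section Modules.
Variable R : nzRingType.
Implicit Types M N X Y : lmodType R.

Lemma submodule_ext M (U V : submodule M) : (forall x, U x <-> V x) -> U = V.
Proof.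
case: U V => [U cU] [V cV] /= UV.
have E : U = V by apply/funext => x; apply/propext.
by subst V; congr Submodule; exact: Prop_irrelevance.
Qed.

Lemma submoduleZ M (U : submodule M) a x : U x -> U (a *: x).
Proof. by move=> Ux; rewrite -[_ *: _]addr0; apply: submoduleD (submodule0 U). Qed.

Lemma submodule_add M (U : submodule M) x y : U x -> U y -> U (x + y).
Proof. by move=> Ux Uy; rewrite -[x]scale1r; exact: submoduleD. Qed.

Lemma submod_valZ M (V : submodule M) a (x : submod V) :
  val (a *: x) = a *: val x.
Proof. by []. Qed.

Lemma submod_valD M (V : submodule M) (x y : submod V) :
  val (x + y) = val x + val y.
Proof. by []. Qed.

Lemma submod_val_in M (V : submodule M) (x : submod V) : V (val x).
Proof. by have /asboolP := submod_valP x. Qed.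

Definition sub_elt M (V : submodule M) x (Vx : V x) : submod V :=
  @Submod R M V x (asboolT Vx).

(** Composing [g] with a set-theoretic section of [f] gives a map independent of the section,
    because the kernels agree; hence it is linear. *)
Lemma iso_of_surj M X Y (f : {linear M -> X}) (g : {linear M -> Y}) :
  surj f -> surj g -> (forall x, f x = 0 <-> g x = 0) -> lmod_iso X Y.
Proof.
move=> sf sg fg.
have fE x y : f x = f y <-> g x = g y.
  split=> E; apply/eqP; rewrite -subr_eq0 -linearB; apply/eqP/fg;
  by rewrite linearB E subrr.
pose s y := projT1 (cid (sf y)); have sK y : f (s y) = y := projT2 (cid (sf y)).
pose u y := projT1 (cid (sg y)); have uK y : g (u y) = y := projT2 (cid (sg y)).
pose h y := g (s y).
have hE x : h (f x) = g x by apply/fE; rewrite sK.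
have hlin : linear h.
  by move=> a x y; rewrite -[x]sK -[y]sK -linearP !hE linearP.
pose hL := GRing.isLinear.Build R X Y _ h hlin.
pose h' : {linear X -> Y} := HB.pack h hL.
exists h'; exists (fun y => f (u y)) => [x|y] /=; last by rewrite hE uK.
by rewrite -[RHS]sK; apply/fE; rewrite uK.
Qed.

Lemma iso_refl M : lmod_iso M M.
Proof. by exists idfun; exists id. Qed.

Lemma iso_sym M N : lmod_iso M N -> lmod_iso N M.
Proof.
move=> [f [g fK gK]]; apply: (@iso_of_surj M N M f idfun).
- by move=> y; exists (g y).
- by move=> y; exists y.
- move=> x; split=> /= [fx|->]; last exact: linear0.
  by apply: (can_inj fK); rewrite fx linear0.
Qed.

Lemma iso_trans M N X : lmod_iso M N -> lmod_iso N X -> lmod_iso M X.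
Proof. by move=> [f bf] [g bg]; exists (g \o f); exact: bij_comp. Qed.

Definition orbit_map M (m : M) (a : R^o) : M := (a : R) *: m.
Fact orbit_map_linear M (m : M) : linear (orbit_map m).
Proof. by move=> a x y; rewrite /orbit_map scalerDl scalerA. Qed.
HB.instance Definition _ M (m : M) :=
  GRing.isLinear.Build R R^o M _ (orbit_map m) (orbit_map_linear m).

(** Both modules are the quotient of the regular module by the annihilator of the generator. *)
Lemma iso_cyclic M N (x : M) (y : N) :
  (forall z, exists a, a *: x = z) -> (forall z, exists a, a *: y = z) ->
  (forall a, a *: x = 0 <-> a *: y = 0) -> lmod_iso M N.
Proof. by move=> sx sy E; exact: (@iso_of_surj R^o M N (orbit_map x) (orbit_map y)). Qed.

Lemma quot_lift M N (U : submodule M) (f : {linear M -> N}) :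
  (forall x, U x -> f x = 0) ->
  exists g : {linear quotmod U -> N}, forall x, g (quotmod_pi U x) = f x.
Proof.
move=> Uf; pose g (y : quotmod U) := f (quotmod_repr y).
have gE x : g (quotmod_pi U x) = f x.
  apply/eqP; rewrite -subr_eq0 -linearB; apply/eqP/Uf/quotmod_piE.
  exact: quotmod_reprK.
have glin : linear g.
  move=> a x y; rewrite -[x]quotmod_reprK -[y]quotmod_reprK.
  by rewrite -linearP !gE linearP.
pose g' : {linear quotmod U -> N} :=
  HB.pack g (GRing.isLinear.Build R _ _ _ g glin).
by exists g'.
Qed.

Definition subquot_pi M (V U : submodule M) x (Vx : V x) : subquot V U :=
  quotmod_pi (restr V U) (sub_elt Vx).

Lemma subquot_pi0 M (V U : submodule M) x (Vx : V x) : subquot_pi U Vx = 0 <-> U x.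
Proof.
rewrite -[0](linear0 (quotmod_pi (restr V U))) /subquot_pi.
by rewrite quotmod_piE subr0.
Qed.

Lemma subquot_piP M (V U : submodule M) (z : subquot V U) :
  exists x (Vx : V x), z = subquot_pi U Vx.
Proof.
exists (val (quotmod_repr z)), (submod_val_in _).
by rewrite -[LHS]quotmod_reprK; congr quotmod_pi; apply: val_inj.
Qed.

Lemma subquot_pi_eq M (V U : submodule M) x y (Vx : V x) (Vy : V y) :
  subquot_pi U Vx = subquot_pi U Vy <-> U (x - y).
Proof. by rewrite /subquot_pi quotmod_piE. Qed.

Lemma subquot_piZ M (V U : submodule M) a x (Vx : V x) :
  a *: subquot_pi U Vx = subquot_pi U (submoduleZ a Vx).
Proof.
by rewrite /subquot_pi -linearZ; congr quotmod_pi; apply: val_inj.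
Qed.

(** Surjectivity is asked only modulo [U'], so that [h] may be right multiplication by an element
    whose multiples do not exhaust [V']. *)
Lemma subquot_iso M N (h : {linear M -> N}) (V U : submodule M) (V' U' : submodule N) :
  (forall x, V x -> V' (h x)) ->
  (forall y, V' y -> exists2 x, V x & U' (y - h x)) ->
  (forall x, V x -> (U x <-> U' (h x))) ->
  lmod_iso (subquot V U) (subquot V' U').
Proof.
move=> hV hs hU.
pose g (x : submod V) := subquot_pi U' (hV _ (submod_val_in x)).
have glin : linear g.
  move=> a x y; rewrite /g subquot_piZ -[RHS]quotmod_piD.
  by congr quotmod_pi; apply: val_inj; rewrite /= linearP.
pose g' : {linear submod V -> subquot V' U'} :=
  HB.pack g (GRing.isLinear.Build R _ _ _ g glin).
apply: (@iso_of_surj _ _ _ (quotmod_pi (restr V U)) g').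
- by move=> y; exists (quotmod_repr y); exact: quotmod_reprK.
- move=> y; have [y0 [Vy ->]] := subquot_piP y; have [x Vx xy] := hs _ Vy.
  exists (sub_elt Vx); symmetry; apply/subquot_pi_eq; exact: xy.
- move=> x; rewrite -[0](linear0 (quotmod_pi (restr V U))) quotmod_piE subr0.
  by rewrite /= /g subquot_pi0 /restr_set /=; exact/hU/submod_val_in.
Qed.

Lemma simple_iso M N : lmod_iso M N -> simple M -> simple N.
Proof.
move=> [f [g fK gK]] [[x x0] sM]; split.
  by exists (f x) => fx; apply: x0; apply: (can_inj fK); rewrite fx linear0.
move=> U.
have cU : submod_closed [in ([set x | U (f x)] : set M)].
  apply: submoduleP => [|a y z Uy Uz] /=; first by rewrite linear0; exact: submodule0.
  by rewrite linearP; exact: submoduleD.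
have [U0|UT] := sM (Submodule cU); [left|right] => y.
  by move=> Uy; rewrite -[y]gK (U0 (g y)) ?linear0 //= gK.
by rewrite -[y]gK; exact: UT.
Qed.

Lemma simple_gen M (x : M) : simple M -> x <> 0 ->
  forall y, exists a, a *: x = y.
Proof.
move=> [_ sM] x0 y.
have cU : submod_closed [in ([set y | exists a, a *: x = y] : set M)].
  apply: submoduleP => [|a _ _ [b <-] [c <-]] /=.
    by exists 0; rewrite scale0r.
  by exists (a * b + c); rewrite scalerDl scalerA.
have [U0|] := sM (Submodule cU); last exact.
by case: x0; apply: U0; exists 1; rewrite scale1r.
Qed.

(** Unlike [filtered], this form lives inside one ambient module and can be extended by one layer at
    a time; [fil_chain] turns it into an indexed chain. *)
Inductive fil (C : lmodType R -> Prop) (M : lmodType R) : submodule M -> Prop :=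
| Fil0 (U : submodule M) of (forall x, U x -> x = 0) : fil C U
| FilS (U V : submodule M) of fil C U & (forall x, U x -> V x) & C (subquot V U) :
  fil C V.

Lemma fil_chain (C : lmodType R -> Prop) M (V : submodule M) : fil C V ->
  exists m (F : nat -> submodule M), [/\ forall x, F 0%N x <-> x = 0,
     F m = V, forall t, (t <= m)%N -> forall x, F t x -> V x,
     forall t, (t < m)%N -> forall x, F t x -> F t.+1 x
    & forall t, (t < m)%N -> C (subquot (F t.+1) (F t))].
Proof.
elim=> {V} [U U0|U V _ [m [F [F0 Fm FV Fs FC]]] UV CUV].
  exists 0%N, (fun=> U); split=> // x; split=> [/U0//|->]; exact: submodule0.
exists m.+1, (fun t => if (t <= m)%N then F t else V).
split=> [x||t _ x|t|t]; first by rewrite leq0n.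
- by rewrite ltnn.
- by case: leqP => // tm /(FV _ tm)/UV.
- rewrite ltnS => tm x /=; rewrite tm; case: ltnP => [|mt]; first by move=> /Fs; exact.
  by rewrite (@anti_leq t m) ?tm // Fm; exact: UV.
- rewrite ltnS => tm /=; rewrite tm; case: ltnP => [|mt]; first exact: FC.
  by rewrite (@anti_leq t m) ?tm // Fm.
Qed.

Definition preim_set M N (h : {linear M -> N}) (U : submodule N) : set M :=
  [set x | U (h x)].
Fact preim_closed M N (h : {linear M -> N}) (U : submodule N) :
  submod_closed [in preim_set h U].
Proof.
apply: submoduleP => [|a y z Uy Uz]; rewrite /preim_set /=.
  by rewrite linear0; exact: submodule0.
by rewrite linearP; exact: submoduleD.
Qed.
Definition preim M N (h : {linear M -> N}) (U : submodule N) : submodule M :=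
  Submodule (preim_closed h U).

(** Serves for the kernel of [cover_q], which is a submodule of a submodule of [A], whereas its
    filtration is built among the submodules of [A]. *)
Lemma fil_filtered (C : lmodType R -> Prop) M N (V : submodule N)
    (h : {linear M -> N}) :
  (forall X Y, lmod_iso X Y -> C X -> C Y) ->
  injective h -> (forall y, V y <-> exists x, h x = y) ->
  fil C V -> filtered C M.
Proof.
move=> Ciso hi hV /fil_chain[m [F [F0 Fm FV Fs FC]]].
exists m, (fun t => preim h (F t)); split=> /=.
- move=> x; rewrite /preim_set /= F0; split=> [E|->]; last exact: linear0.
  by apply: hi; rewrite E linear0.
- by move=> x; rewrite /preim_set /= Fm; apply/hV; exists x.
- by move=> t tm x; exact: Fs.
- move=> t tm; apply: Ciso (FC t tm); apply: iso_sym.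
  apply: (subquot_iso (h := h)) => //= y Fy.
  have [x xy] := (hV y).1 (FV _ tm _ Fy).
  exists x; first by rewrite /preim_set /= xy.
  by rewrite -xy subrr; exact: submodule0.
Qed.

Definition fullsm M : submodule M :=
  ker (\0 : {linear M -> M}).

Lemma fil_full (C : lmodType R -> Prop) M (V : submodule M) :
  (forall x, V x) -> fil C V -> filtered C M.
Proof.
move=> VT /fil_chain[m [F [F0 Fm FV Fs FC]]].
by exists m, F; split=> // x; rewrite Fm.
Qed.

(* A strictly monotone rank bounds the length of chains of submodules. *)
Definition finite_length M := exists d : submodule M -> nat, forall U V : submodule M,
  (forall x, U x -> V x) -> (exists2 x, V x & ~ U x) -> (d U < d V)%N.

Lemma finite_length_preim M N (F : submodule M -> submodule N) : finite_length N ->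
  (forall U V : submodule M, (forall x, U x -> V x) -> forall y, F U y -> F V y) ->
  (forall U V : submodule M, (forall x, U x -> V x) -> (exists2 x, V x & ~ U x) ->
     exists2 y, F V y & ~ F U y) ->
  finite_length M.
Proof.
move=> [d dP] F1 F2; exists (d \o F) => U V UV xUV /=.
by apply: dP; [exact: F1 | exact: F2].
Qed.

Lemma finite_length_quot M (U : submodule M) :
  finite_length M -> finite_length (quotmod U).
Proof.
move=> lM; apply: (finite_length_preim (F := preim (quotmod_pi U)) lM).
  by move=> V W VW y; exact: VW.
move=> V W _ [x Wx Vx]; exists (quotmod_repr x); rewrite /preim /preim_set /=;
by rewrite quotmod_reprK.
Qed.

Lemma finite_length_sub M (U : submodule M) : finite_length M -> finite_length (submod U).
Proof.
have cI (V : submodule (submod U)) :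
    submod_closed [in ([set x | exists2 y, V y & val y = x] : set M)].
  apply: submoduleP => [|a _ _ [y Vy <-] [z Vz <-]] /=.
    by exists 0 => //; exact: submodule0.
  by exists (a *: y + z) => //; exact: submoduleD.
move=> lM; apply: (finite_length_preim (F := fun V => Submodule (cI V)) lM) => /=.
  by move=> V W VW y [z Vz <-]; exists z => //; exact: VW.
move=> V W _ [x Wx Vx]; exists (val x) => /=; first by exists x.
by move=> [y Vy /val_inj E]; apply: Vx; rewrite -E.
Qed.

Lemma finite_length_fil M (U : submodule M) : finite_length M -> fil (@simple R) U.
Proof.
move=> [d dP]; have [k] := ubnP (d U); elim: k U => // k IHk U dU.
have [U0|/existsNP[x0 /not_implyP[Ux0 x00]]] := pselect (forall x, U x -> x = 0).
  exact: Fil0.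
(* Ranks of proper submodules of [U] are bounded by the rank of [U]; a proper submodule of largest
   rank has a simple quotient. *)
pose proper (j : nat) := `[< exists V : submodule M, [/\ d V = j,
   forall x, V x -> U x & exists2 x, U x & ~ V x] >].
have exP : exists j, proper j.
  have c0 : submod_closed [in ([set x | x = 0] : set M)].
    by apply: submoduleP => // a x y -> ->; rewrite scaler0 addr0.
  exists (d (Submodule c0)); apply/asboolP; exists (Submodule c0); split=> //=.
    by move=> x ->; exact: submodule0.
  by exists x0.
have ubP j : proper j -> (j <= d U)%N.
  by move=> /asboolP[V [<- VU xV]]; apply: ltnW; exact: dP.
case: (ex_maxnP exP ubP) => j /asboolP[V [dV VU xV]] jmax.
apply: (@FilS _ _ V U) => //; first by apply: IHk; apply: leq_trans (dP _ _ VU xV) _.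
split.
  by case: xV => x Ux Vx; exists (subquot_pi V Ux) => /subquot_pi0.
move=> W.
have cW : submod_closed [in ([set x | exists Ux : U x, W (subquot_pi V Ux)] : set M)].
  apply: submoduleP => [|a x y [Ux Wx] [Uy Wy]] /=.
    exists (submodule0 U); rewrite (_ : subquot_pi _ _ = 0); first exact: submodule0.
    by apply/subquot_pi0; exact: submodule0.
  exists (submoduleD a Ux Uy);
  rewrite (_ : subquot_pi _ _ = a *: subquot_pi V Ux + subquot_pi V Uy).
    exact: submoduleD.
  by rewrite /subquot_pi -linearP; congr quotmod_pi; apply: val_inj.
pose W' := Submodule cW.
have VW x : V x -> W' x.
  move=> Vx; exists (VU _ Vx); rewrite (_ : subquot_pi _ _ = 0); first exact: submodule0.
  by apply/subquot_pi0.
have WU x : W' x -> U x by case.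
have [UW|/existsNP[x /not_implyP[Ux Wx]]] := pselect (forall x, U x -> W' x).
  right=> z; have [x [Ux ->]] := subquot_piP z; have [Ux'] := UW _ Ux.
  by rewrite (Prop_irrelevance Ux' Ux).
left=> z Wz; have [y [Uy E]] := subquot_piP z; rewrite E; apply/subquot_pi0.
have [//|Vy] := pselect (V y).
have : (d V < d W')%N.
  by apply: dP => //; exists y => //; exists Uy; rewrite -E.
rewrite ltnNge => /negP[]; rewrite dV; apply: jmax; apply/asboolP.
by exists W'; split=> //; exists x.
Qed.

Lemma finite_length_filtered M : finite_length M -> filtered (@simple R) M.
Proof.
by move=> lM; apply: (@fil_full _ _ (fullsm M)) => //; exact: finite_length_fil.
Qed.

(** Since [a *: x] is fixed by the idempotent [a], its class in the first layer that it enters is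
    nonzero and still fixed by [a]. *)
Lemma filtration_factor (C : lmodType R -> Prop) M m (F : nat -> submodule M)
    (a : R) (x : M) :
  filtration C m F -> a * a = a -> a *: x <> 0 ->
  exists2 t, (t < m)%N & exists y : subquot (F t.+1) (F t), a *: y <> 0.
Proof.
move=> [F0 Fm Fs FC] aa ax0; set x' := a *: x in ax0.
have exF : exists t, `[< F t x' >] by exists m; apply/asboolP.
case: (ex_minnP exF) => t /asboolP Ftx tmin.
case: t => [|t] in Ftx tmin *; first by case: ax0; apply/F0.
have tm : (t < m)%N by apply: tmin; apply/asboolP.
exists t => //; exists (subquot_pi (F t) Ftx); rewrite subquot_piZ => /subquot_pi0.
rewrite /x' scalerA aa => Ft.
by have := tmin t (asboolT Ft); rewrite ltnn.
Qed.

Lemma subquot_scale0 M (V U : submodule M) (a : R) :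
  (forall x : M, a *: x = 0) -> forall y : subquot V U, a *: y = 0.
Proof.
move=> a0 y; have [x [Vx ->]] := subquot_piP y; rewrite subquot_piZ; apply/subquot_pi0.
by rewrite a0; exact: submodule0.
Qed.

Lemma iso_scale0 M N (a : R) : lmod_iso M N ->
  (forall x : M, a *: x = 0) -> forall y : N, a *: y = 0.
Proof.
by move=> [f [g fK gK]] a0 y; rewrite -[y]gK -linearZ a0 linear0.
Qed.

Lemma composition_factor_iso M N X : lmod_iso M N ->
  composition_factor M X -> composition_factor N X.
Proof.
move=> /iso_sym[h [g hK gK]] [m [F [[F0 Fm Fs FC] [t tm iX]]]].
have sqi s : lmod_iso (subquot (preim h (F s.+1)) (preim h (F s)))
                 (subquot (F s.+1) (F s)).
  apply: (subquot_iso (h := h)) => // y Fy.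
  exists (g y); first by rewrite /preim /preim_set /= gK.
  by rewrite gK subrr; exact: submodule0.
exists m, (fun s => preim h (F s)); split; last first.
  by exists t => //; exact: iso_trans (sqi t) iX.
split=> [x|x|s sm x|s sm]; rewrite /preim /preim_set /=.
- rewrite F0; split=> [E|->]; last exact: linear0.
  by apply: (can_inj hK); rewrite E linear0.
- exact: Fm.
- exact: Fs.
- exact: simple_iso (iso_sym (sqi s)) (FC _ sm).
Qed.

End Modules.

Section StandardUniqueness.
Variables (R : nzRingType) (I : finType) (L : I -> lmodType R) (le : rel I).

Lemma factors_below_iso i X Y : lmod_iso X Y ->
  factors_below L le i X -> factors_below L le i Y.
Proof.
by move=> XY fX Z cZ; apply: fX; apply: composition_factor_iso cZ; exact: iso_sym.
Qed.

Lemma projective_cover_surj (P P' M : lmodType R) (p : {linear P -> M})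
    (p' : {linear P' -> M}) (h : {linear P -> P'}) :
  surj p -> projective_cover p' -> (forall x, p' (h x) = p x) -> surj h.
Proof.
move=> sp [_ _ sup] hE.
have cU : submod_closed [in ([set y | exists x, h x = y] : set P')].
  apply: submoduleP => [|a _ _ [x <-] [y <-]] /=; first by exists 0; rewrite linear0.
  by exists (a *: x + y); rewrite linearP.
apply: (sup (Submodule cU)) => y; have [x xy] := sp (p' y).
exists (h x), (y - h x); split; first by exists x.
  by rewrite linearB hE xy subrr.
by rewrite addrC subrK.
Qed.

(** A section of the surjection [h] is again a map of covers, hence onto, hence a two-sided
    inverse. *)
Lemma projective_cover_unique (P P' M : lmodType R) (p : {linear P -> M})
    (p' : {linear P' -> M}) :
  projective_cover p -> projective_cover p' ->
  exists2 h : {linear P -> P'}, bijective h & forall x, p' (h x) = p x.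
Proof.
move=> cp cp'; have [pP sp _] := cp; have [pP' sp' _] := cp'.
have [h hE] := pP _ _ p' p sp'; have sh := projective_cover_surj sp cp' hE.
have [s sE] := pP' _ _ h idfun sh.
have ss : surj s.
  by apply: (projective_cover_surj sp' cp) => x; rewrite -hE sE.
exists h => //; exists s => // x.
by have [y <-] := ss x; rewrite sE.
Qed.

Lemma standard_data_unique i (P P' D D' : lmodType R) (p : {linear P -> L i})
    (p' : {linear P' -> L i}) (q : {linear P -> D}) (q' : {linear P' -> D'}) :
  standard_data le p q -> standard_data le p' q' -> lmod_iso D D'.
Proof.
move=> [cp qs fD mq] [cp' qs' fD' mq'].
(* [q2 \o h] makes [D2] a quotient of [P1] with admissible factors, so the maximality clause puts
   the kernel of [q1] inside the kernel of [q2 \o h]. *)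
have half (P1 P2 D1 D2 : lmodType R) (q1 : {linear P1 -> D1})
    (q2 : {linear P2 -> D2}) (h : {linear P1 -> P2}) : surj h ->
    surj q2 -> factors_below L le i D2 ->
    (forall U : submodule P1, factors_below L le i (quotmod U) ->
        forall x, q1 x = 0 -> U x) -> forall x, q1 x = 0 -> q2 (h x) = 0.
  move=> sh s2 f2 m1 x q1x; apply: (m1 (ker (q2 \o h))) q1x.
  apply: factors_below_iso f2.
  apply: (@iso_of_surj _ P1 _ _ (q2 \o h) (quotmod_pi (ker (q2 \o h)))).
  - by move=> y; have [z <-] := s2 y; have [w <-] := sh z; exists w.
  - by move=> y; exists (quotmod_repr y); exact: quotmod_reprK.
  - move=> y; rewrite -[in X in _ <-> X](linear0 (quotmod_pi (ker (q2 \o h)))).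
    by rewrite quotmod_piE subr0.
have [h [g hK gK] _] := projective_cover_unique cp cp'.
have [g' [h' g'K h'K] _] := projective_cover_unique cp' cp.
apply: (@iso_of_surj _ P _ _ q (q' \o h)) => //.
  by move=> y; have [z <-] := qs' y; exists (g z); rewrite /= gK.
move=> x; split; first by apply: half => // y; exists (g y); rewrite gK.
move=> /= q'hx.
have glin : linear g.
  by move=> a y z; apply: (can_inj hK); rewrite linearP !gK.
pose gL : {linear P' -> P} := HB.pack g (GRing.isLinear.Build R P' P _ g glin).
rewrite -[x]hK -[g _]/(gL _); apply: half q'hx => // y.
by exists (h y); rewrite /= hK.
Qed.

End StandardUniqueness.

(** * Idempotents of finite dimensional algebras *)

Section FiniteDimension.
Variables (k : fieldType).

(** A subspace of largest dimension inside [P] is all of [P], since a further vector of [P] could be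
    adjoined. This gives classical subsets a dimension. *)
Lemma vspace_of (V : vectType k) (P : set V) : P 0 ->
  (forall c x y, P x -> P y -> P (c *: x + y)) ->
  exists W : {vspace V}, forall x, x \in W <-> P x.
Proof.
move=> P0 PD.
pose fits (j : nat) := `[< exists W : {vspace V}, \dim W = j /\
  forall x, x \in W -> P x >].
have exf : exists j, fits j.
  by exists 0%N; apply/asboolP; exists 0%VS; rewrite dimv0; split=> // x /[!memv0] /eqP->.
have ub j : fits j -> (j <= \dim {:V})%N.
  by move=> /asboolP[W [<- _]]; rewrite dimvS ?subvf.
case: (ex_maxnP exf ub) => j /asboolP[W [dW WP]] jmax; exists W => x.
split=> [/WP//|Px]; apply/contraT => xW.
have : fits (\dim (<[x]> + W)%VS).
  apply/asboolP; exists (<[x]> + W)%VS; split=> // y.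
  by move=> /memv_addP[_ /vlineP[c ->] [w /WP Pw ->]]; exact: PD.
move=> /jmax; rewrite -dW leqNgt => /negP[].
rewrite ltn_neqAle dimvS ?addvSr // andbT; apply: contra xW => /eqP E.
have /eqP -> : W == (<[x]> + W)%VS by rewrite eqEdim addvSr E /=.
by rewrite -{1}[x]addr0 memv_add ?memv_line ?mem0v.
Qed.

Lemma functionalE (V : lmodType k) (f : V -> k) :
  (forall c x y, f (c *: x + y) = c * f x + f y) ->
  [/\ f 0 = 0, {morph f : x y / x + y}, {morph f : x y / x - y}
    & forall c x, f (c *: x) = c * f x].
Proof.
move=> flin; have f0 : f 0 = 0.
  by have := flin (-1) 0 0; rewrite scaler0 addr0 mulN1r addNr.
split=> // [x y|x y|c x].
- by have := flin 1 x y; rewrite scale1r mul1r.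
- by rewrite addrC -scaleN1r flin mulN1r addrC.
- by have := flin c x 0; rewrite f0 !addr0.
Qed.

(** Some coordinate is nonzero on the difference between [g] and its projection to [W]; it is
    composed with that complementary projection and rescaled. *)
Lemma separating_functional (V : vectType k) (W : {vspace V}) (g : V) :
  g \notin W -> exists f : V -> k,
    [/\ forall c x y, f (c *: x + y) = c * f x + f y,
        forall x, x \in W -> f x = 0 & f g = 1].
Proof.
move=> gW; set h := g - projv W g.
have hn0 : h != 0.
  apply: contra gW; rewrite subr_eq0 => /eqP->; exact: memv_proj.
have [s hs] : exists s, coord (vbasis {:V}) s h != 0.
  apply/existsP; rewrite -[[exists _, _]]negbK negb_exists.
  apply: contra hn0 => /forallP h0.
  rewrite (coord_vbasis (memvf h)) big1 // => i _.
  by have /[!negbK] /eqP-> := h0 i; rewrite scale0r.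
exists (fun x => (coord (vbasis {:V}) s h)^-1 *
                 coord (vbasis {:V}) s (x - projv W x)).
split=> [c x y|x xW|]; last by rewrite mulVf.
  rewrite linearP opprD addrACA -scalerBr linearP /=.
  by rewrite mulrDr mulrCA.
by rewrite projv_id // subrr linear0 mulr0.
Qed.

Variable A : falgType k.

Lemma mem_amulr (u x : A) : x \in (amulr u @: fullv)%VS <-> exists a, x = a * u.
Proof.
split=> [/memv_imgP[a _ ->]|[a ->]]; first by exists a; rewrite lfunE.
by apply/memv_imgP; exists a; rewrite ?memvf // lfunE.
Qed.

Lemma submodule_kscale (U : submodule (A : nzRingType)^o) (c : k) (x : A) :
  U x -> U (c *: x).
Proof. by move=> Ux; rewrite -[c *: x]mulr_algl; exact: (submoduleZ (c%:A) Ux). Qed.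

Lemma vspace_of_submodule (U : submodule (A : nzRingType)^o) :
  exists W : {vspace A}, forall x, x \in W <-> U x.
Proof.
apply: vspace_of => [|c x y Ux Uy]; first exact: submodule0.
exact: submodule_add (submodule_kscale c Ux) Uy.
Qed.

Lemma finite_length_regular : finite_length (A : nzRingType)^o.
Proof.
exists (fun U => \dim (projT1 (cid (vspace_of_submodule U)))) => U V UV [x Vx Ux].
case: (cid (vspace_of_submodule U)) => WU EU.
case: (cid (vspace_of_submodule V)) => WV EV /=.
have sUV : (WU <= WV)%VS by apply/subvP => y /EU/UV/EV.
rewrite ltn_neqAle dimvS // andbT; apply/negP => /eqP E; apply: Ux.
apply/EU; have /eqP -> : WU == WV by rewrite eqEdim sUV E /=.
exact/EV.
Qed.

(* Fitting: right multiplication by a suitable power [w] of [u] is bijective   *)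
(* on [A w], and the preimage of [w] is an idempotent.                         *)
Lemma fitting_idempotent (M : lmodType A) (x : M) (eps u : A) :
  eps * eps = eps -> eps * u = u -> u * eps = u ->
  eps *: x <> 0 -> u *: x = eps *: x ->
  exists f b, [/\ f = b * u, f * f = f, f * eps = f, eps * f = f & f *: x <> 0].
Proof.
move=> ee eu ue x0 ux.
pose I (v : A) := (amulr v @: fullv)%VS.
pose dims (j : nat) := `[< exists2 m, (0 < m)%N & \dim (I (u ^+ m)) = j >].
have exd : exists j, dims j.
  by exists (\dim (I (u ^+ 1))); apply/asboolP; exists 1%N.
(* [w] is a power of [u] for which [A w] has least dimension, so [A w w] cannot be smaller than
   [A w]. *)
case: (ex_minnP exd) => j /asboolP[m m0 dm] jmin.
set w := u ^+ m in dm.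
have ew : eps * w = w by rewrite /w -(prednK m0) exprS mulrA eu.
have we : w * eps = w by rewrite /w -(prednK m0) exprSr -mulrA ue.
have ux' : u *: (eps *: x) = eps *: x by rewrite scalerA ue.
have wx : w *: (eps *: x) = eps *: x.
  rewrite /w; elim: (m) => [|i IHi]; first by rewrite expr0 scale1r.
  by rewrite exprS -scalerA IHi.
have sww : (I (w * w)%R <= I w)%VS.
  apply/subvP => y /mem_amulr[a ->]; apply/mem_amulr; exists (a * w).
  by rewrite mulrA.
have IwE : I (w * w) = I w.
  apply/eqP; rewrite eqEdim sww dm; apply: jmin; apply/asboolP.
  by exists (m + m)%N; rewrite ?addn_gt0 ?m0 // exprD.
have img : (amulr w @: I w)%VS = I w.
  rewrite -[RHS]IwE; apply/vspaceP => y; apply/idP/idP.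
    move=> /memv_imgP[z /mem_amulr[a ->] ->]; apply/mem_amulr; exists a.
    by rewrite lfunE /= mulrA.
  move=> /mem_amulr[a ->]; apply/memv_imgP; exists (a * w).
    by apply/mem_amulr; exists a.
  by rewrite lfunE /= mulrA.
have kw z : z \in I w -> z * w = 0 -> z = 0.
  move=> zI zw; have := limg_ker_dim (amulr w) (I w).
  rewrite img => /eqP; rewrite -[X in _ == X]add0n eqn_add2r dimv_eq0 => /eqP K.
  apply/eqP; rewrite -memv0 -K memv_cap zI memv_ker lfunE /=.
  exact/eqP.
(* As [w] lies in [A w w], there is [c] with [w = c w w]. The idempotent is [c w]; its identities
   hold after multiplication by [w], which is injective on [A w]. *)
have : w \in I w by apply/mem_amulr; exists 1; rewrite mul1r.
rewrite -{1}IwE => /mem_amulr[c wc].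
exists (c * w), (c * u ^+ m.-1).
have fI : c * w \in I w by apply/mem_amulr; exists c.
have fw : c * w * w = w by rewrite -mulrA -wc.
split.
- by rewrite -mulrA -exprSr prednK.
- apply/eqP; rewrite -subr_eq0; apply/eqP/kw.
    by rewrite memvB //; apply/mem_amulr; exists (c * w * c); rewrite !mulrA.
  by rewrite mulrBl -(mulrA (c * w) (c * w) w) !fw subrr.
- by rewrite -mulrA we.
- apply/eqP; rewrite -subr_eq0; apply/eqP/kw.
    by rewrite memvB //; apply/mem_amulr; exists (eps * c); rewrite !mulrA.
  by rewrite mulrBl -(mulrA eps (c * w) w) !fw ew subrr.
- move=> fx0; apply: x0; rewrite -wx -{1}fw -scalerA wx scalerA.
  by rewrite -mulrA we.
Qed.

(* When [x] generates a simple module, [A eps] is its projective cover. *)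
Lemma minimal_idempotent (M : lmodType A) (x : M) (e0 : A) :
  e0 * e0 = e0 -> e0 *: x <> 0 ->
  exists eps, [/\ eps * eps = eps, e0 * eps = eps, eps * e0 = eps, eps *: x <> 0
    & forall f, f * f = f -> f * eps = f -> eps * f = f -> f *: x <> 0 ->
        exists a, eps = a * f].
Proof.
move=> ee ex0.
pose ok (eps : A) :=
  [/\ eps * eps = eps, e0 * eps = eps, eps * e0 = eps & eps *: x <> 0].
pose dims (j : nat) := `[< exists2 eps, ok eps & \dim (amulr eps @: fullv)%VS = j >].
have exd : exists j, dims j.
  by exists (\dim (amulr e0 @: fullv)%VS); apply/asboolP; exists e0.
(* [A eps] has least dimension among the admissible idempotents. For [f] below [eps], [A f] lies in
   [A eps], so the two are equal. *)
case: (ex_minnP exd) => j /asboolP[eps [epp e0p pe0 px] dj] jmin.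
exists eps; split=> // f ff fe ef fx.
have dle : (j <= \dim (amulr f @: fullv))%N.
  apply: jmin; apply/asboolP; exists f => //; split=> //.
    by rewrite -ef mulrA e0p.
  by rewrite -fe -mulrA pe0.
have /eqP E : ((amulr f @: fullv) == (amulr eps @: fullv))%VS.
  rewrite eqEdim dj dle andbT; apply/subvP => y /mem_amulr[a ->].
  by apply/mem_amulr; exists (a * f); rewrite -mulrA fe.
by apply/mem_amulr; rewrite E; apply/mem_amulr; exists 1; rewrite mul1r.
Qed.

End FiniteDimension.

(** * The heredity property *)

Section Heredity.
Variables (k : fieldType) (A : falgType k) (n : nat).
Variables (e : 'I_n.+1 -> A) (deg : 'I_n.+1 -> nat).

Definition msum (r : seq ('I_n.+1 * A * A)) : A :=
  \sum_(p <- r) p.1.2 * e p.1.1 * p.2.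

(** The two-sided ideal [A_{<d}], given by finite sums so that membership provides an explicit
    expression to manipulate. *)
Definition trace_ideal (d : nat) (x : A) : Prop :=
  exists2 r, all (fun p => deg p.1.1 < d)%N r & x = msum r.

(* The bimodule A_{<= d} / A_{< d} is the direct sum over deg l = d of the     *)
(* Delta(l) (x) e_l A / (e_l A_{< d}): injectivity of multiplication is stated *)
(* by contracting the second factor with functionals.                          *)
Record heredity : Prop := Heredity {
  her_orth : forall i j, e i * e j = if i == j then e i else 0;
  her_compl : \sum_i e i = 1;
  her_off : forall i j a, j != i -> deg j = deg i ->
    trace_ideal (deg i) (e j * a * e i);
  her_diag : forall i a, exists c,
    trace_ideal (deg i) (e i * a * e i - c *: e i);
  her_inj : forall d r (f : A -> k) l,
    all (fun p => deg p.1.1 == d) r -> trace_ideal d (msum r) ->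
    (forall c x y, f (c *: x + y) = c * f x + f y) ->
    (forall x, trace_ideal d x -> f x = 0) ->
    trace_ideal d
      (\sum_(p <- r | p.1.1 == l) f (e l * p.2) *: (p.1.2 * e l))
}.

Lemma msum_cat r s : msum (r ++ s) = msum r + msum s.
Proof. by rewrite /msum big_cat. Qed.

Lemma msum_mull a r : msum [seq (p.1.1, a * p.1.2, p.2) | p <- r] = a * msum r.
Proof.
by rewrite /msum big_map mulr_sumr; apply: eq_bigr => p _; rewrite /= !mulrA.
Qed.

Lemma msum_mulr b r : msum [seq (p.1.1, p.1.2, p.2 * b) | p <- r] = msum r * b.
Proof.
by rewrite /msum big_map mulr_suml; apply: eq_bigr => p _; rewrite /= !mulrA.
Qed.

Lemma trace_ideal0 d : trace_ideal d 0.
Proof. by exists [::] => //; rewrite /msum big_nil. Qed.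

Lemma trace_idealD d x y : trace_ideal d x -> trace_ideal d y ->
  trace_ideal d (x + y).
Proof.
by move=> [r dr ->] [s ds ->]; exists (r ++ s); rewrite ?all_cat ?dr // msum_cat.
Qed.

Lemma trace_ideal_mull d a x : trace_ideal d x -> trace_ideal d (a * x).
Proof.
move=> [r dr ->]; exists [seq (p.1.1, a * p.1.2, p.2) | p <- r].
  by rewrite all_map.
by rewrite msum_mull.
Qed.

Lemma trace_ideal_mulr d b x : trace_ideal d x -> trace_ideal d (x * b).
Proof.
move=> [r dr ->]; exists [seq (p.1.1, p.1.2, p.2 * b) | p <- r].
  by rewrite all_map.
by rewrite msum_mulr.
Qed.

Lemma trace_idealZ d c x : trace_ideal d x -> trace_ideal d (c *: x).
Proof. by move=> ?; rewrite -mulr_algl; exact: trace_ideal_mull. Qed.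

Lemma trace_idealB d x y : trace_ideal d x -> trace_ideal d y ->
  trace_ideal d (x - y).
Proof.
by move=> Jx Jy; rewrite -scaleN1r; apply: trace_idealD => //; exact: trace_idealZ.
Qed.

Lemma trace_ideal_sum (I : Type) (s : seq I) (P : pred I) d (F : I -> A) :
  (forall i, P i -> trace_ideal d (F i)) -> trace_ideal d (\sum_(i <- s | P i) F i).
Proof.
move=> JF; apply: big_ind => //; [exact: trace_ideal0 | exact: trace_idealD].
Qed.

Lemma trace_ideal_mem d j a b : (deg j < d)%N -> trace_ideal d (a * e j * b).
Proof.
by move=> jd; exists [:: (j, a, b)]; rewrite /= ?jd // /msum big_seq1.
Qed.

Lemma trace_ideal_ind d (P : A -> Prop) :
  P 0 -> (forall x y, P x -> P y -> P (x + y)) ->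
  (forall j a b, (deg j < d)%N -> P (a * e j * b)) ->
  forall x, trace_ideal d x -> P x.
Proof.
move=> P0 PD Pe x [r /allP dr ->]; rewrite /msum big_seq.
by apply: big_ind => // p /dr; exact: Pe.
Qed.

Lemma trace_ideal_mono d d' x : (d <= d')%N -> trace_ideal d x -> trace_ideal d' x.
Proof.
move=> dd'; apply: trace_ideal_ind; [exact: trace_ideal0 | exact: trace_idealD |].
by move=> j a b jd; apply: trace_ideal_mem; exact: leq_trans dd'.
Qed.

Fact trace_lideal_closed d :
  submod_closed [in (trace_ideal d : set (A : nzRingType)^o)].
Proof.
apply: submoduleP => [|a x y Jx Jy]; first exact: trace_ideal0.
by apply: trace_idealD => //; exact: trace_ideal_mull.
Qed.
Definition trace_lideal d : submodule (A : nzRingType)^o :=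
  Submodule (trace_lideal_closed d).

Definition Delta i : lmodType A := subquot (lideal (e i)) (trace_lideal (deg i)).

Lemma trace_ideal_kill (M : lmodType A) d (x : A) :
  (forall j (y : M), (deg j < d)%N -> e j *: y = 0) ->
  trace_ideal d x -> forall y : M, x *: y = 0.
Proof.
move=> ed; move: x; apply: trace_ideal_ind => [y|x z x0 z0 y|j a b jd y].
- exact: scale0r.
- by rewrite scalerDl x0 z0 addr0.
- by rewrite -!scalerA ed // scaler0.
Qed.

(** Small degree is high in the order: the last clause says that nothing in [M] has a weight of
    smaller degree. For simple [M] this determines the isomorphism class, and it lets one argument
    serve both [A] and [A^-]. *)
Definition highest_weight i (M : lmodType A) (x : M) : Prop :=
  [/\ e i *: x = x, x <> 0
    & forall j (y : M), (deg j < deg i)%N -> e j *: y = 0].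

Hypothesis her : heredity.
Let le := reedy_le deg.

Lemma idem i : e i * e i = e i.
Proof. by rewrite her_orth // eqxx. Qed.

Lemma lideal_idemP i (x : (A : nzRingType)^o) : lideal (e i) x <-> x * e i = x :> A.
Proof.
split=> [[a ->]|<-]; last by exists x.
by rewrite -mulrA idem.
Qed.

Lemma kscale_eq0 (M : lmodType A) (c : k) (x : M) :
  c%:A *: x = 0 -> x <> 0 -> c = 0.
Proof.
move=> cx x0; apply/eqP; apply: contra_notT x0 => c0.
by rewrite -[x](scale1r x) -[1](scale1r (1 : A)) -(mulVf c0) -scalerA -mulr_algl
  -scalerA cx scaler0.
Qed.

Lemma off_weight i j a : ~~ le j i -> trace_ideal (deg i) (e j * a * e i).
Proof.
rewrite negb_or -leqNgt leq_eqVlt => /andP[ji /orP[/eqP|] d].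
  exact: her_off.
by rewrite -[e j]mul1r -mulrA; exact: trace_ideal_mem.
Qed.

Lemma highest_weight_kill i (M : lmodType A) (x : M) : highest_weight i x ->
  forall a, trace_ideal (deg i) a -> forall y : M, a *: y = 0.
Proof. by move=> [_ _ ek] a; exact: trace_ideal_kill. Qed.

Lemma weights_simple i (M : lmodType A) (x : M) : simple M -> highest_weight i x ->
  forall j, ~~ le j i -> forall y : M, e j *: y = 0.
Proof.
move=> sM hx j ji y; have [ex x0 _] := hx.
have [a <-] := simple_gen sM x0 y.
rewrite -ex !scalerA; apply: (highest_weight_kill hx).
exact: off_weight.
Qed.

(** If [a *: y] were nonzero, some [b] would give [b a y = y]. But [e_i b a e_i] acts on [x] and on
    [y] by the same scalar, which is [0] on [x] and [1] on [y]. *)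
Lemma highest_weight_ann i (M N : lmodType A) (x : M) (y : N) :
  simple N -> highest_weight i x -> highest_weight i y ->
  forall a, a *: x = 0 -> a *: y = 0.
Proof.
move=> sN hx hy a ax; have [ex x0 _] := hx; have [ey y0 _] := hy.
apply/eqP/contraT => /eqP ay.
have [b bay] := simple_gen sN ay y.
have [c Jc] := her_diag her i (b * a).
have E (K : lmodType A) (z : K) : highest_weight i z ->
    (e i * (b * a) * e i) *: z = c%:A *: z.
  move=> hz; have [ez _ _] := hz.
  have := highest_weight_kill hz Jc z.
  rewrite scalerBl => /eqP; rewrite subr_eq0 => /eqP ->.
  by rewrite -[c *: e i]mulr_algl -scalerA ez.
have : (e i * (b * a) * e i) *: x = 0.
  by rewrite -!scalerA ex ax !scaler0.
rewrite E // => /kscale_eq0 /(_ x0) c0.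
have : (e i * (b * a) * e i) *: y = y by rewrite -!scalerA ey bay ey.
by rewrite E // c0 scale0r scale0r => /esym.
Qed.

Lemma highest_weight_unique i (M N : lmodType A) (x : M) (y : N) :
  simple M -> simple N -> highest_weight i x -> highest_weight i y -> lmod_iso M N.
Proof.
move=> sM sN hx hy; have [_ x0 _] := hx; have [_ y0 _] := hy.
apply: (@iso_cyclic _ _ _ x y) (simple_gen sM x0) (simple_gen sN y0) _ => a.
by split; [exact: highest_weight_ann sN hx hy a | exact: highest_weight_ann sM hy hx a].
Qed.

(** [i] has the least degree among the idempotents that do not kill [M]. *)
Lemma highest_weight_exists (M : lmodType A) : simple M ->
  exists i (x : M), highest_weight i x.
Proof.
move=> [[x x0] _].
pose live (j : nat) := `[< exists i (y : M), deg i = j /\ e i *: y <> 0 >].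
have exl : exists j, live j.
  apply: contra_notP x0 => /forallNP nl.
  rewrite -[x]scale1r -(her_compl her) scaler_suml big1 // => i _.
  apply/eqP/contraT => /eqP eix; case: (nl (deg i)).
  by apply/asboolP; exists i, x.
case: (ex_minnP exl) => j /asboolP[i [y [dj ey]]] jmin.
exists i, (e i *: y); split=> // [|l z dl]; first by rewrite scalerA idem.
apply/eqP/contraT => /eqP ez; have /jmin : live (deg l) by apply/asboolP; exists l, z.
by rewrite -dj leqNgt dl.
Qed.

Lemma le_anti : antisymmetric le.
Proof.
move=> i j /andP[/orP[/eqP//|ij] /orP[/eqP//|ji]].
by have := ltn_trans ij ji; rewrite ltnn.
Qed.

Lemma le_trans : transitive le.
Proof.
move=> j i l /orP[/eqP->//|ij] /orP[/eqP<-|jl]; rewrite /le /reedy_le.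
  by rewrite ij orbT.
by rewrite (ltn_trans jl ij) orbT.
Qed.

Lemma weights_Delta i j : ~~ le j i -> forall z : Delta i, e j *: z = 0.
Proof.
move=> ji z; have [x [Vx ->]] := subquot_piP z; rewrite subquot_piZ; apply/subquot_pi0.
by have [a ->] := Vx; rewrite -[_ *: _]/(e j * (a * e i)) mulrA; exact: off_weight.
Qed.

(** * Composition factors and their weights *)

Section Simples.
Variable L : 'I_n.+1 -> lmodType A.
Hypothesis L_simple : forall i, simple (L i) /\ exists x : L i, highest_weight i x.

Lemma L_complete : complete_simples L.
Proof.
split=> [i|i j Lij|M sM]; first by have [] := L_simple i.
- have half (i' j' : 'I_n.+1) : lmod_iso (L i') (L j') -> le i' j'.
    move=> iso; apply/negPn/negP => nle.
    have [si [x [ex x0 _]]] := L_simple i'; have [sj [y hy]] := L_simple j'.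
    apply: x0; rewrite -ex; apply: iso_scale0 (iso_sym iso) _ _.
    exact: (weights_simple sj hy).
  by apply: le_anti; rewrite half // half //; exact: iso_sym.
- have [i [x hx]] := highest_weight_exists sM; exists i.
  by have [si [y hy]] := L_simple i; exact: highest_weight_unique hx hy.
Qed.

Lemma L_alive j (M : lmodType A) : lmod_iso M (L j) ->
  ~ (forall y : M, e j *: y = 0).
Proof.
move=> iso ej; have [_ [x [ex x0 _]]] := L_simple j.
by apply: x0; rewrite -ex; exact: iso_scale0 iso ej x.
Qed.

Lemma factors_below_Delta i : factors_below L le i (Delta i).
Proof.
move=> Y [m [F [[_ _ _ FC] [t tm iY]]]].
have [_ _ Lall] := L_complete.
have [j iL] := Lall _ (simple_iso iY (FC t tm)).
exists j => //; apply/negPn/negP => ji; apply: (L_alive iL).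
by apply: iso_scale0 iY _; apply: subquot_scale0; exact: weights_Delta.
Qed.

(** An idempotent acting nontrivially on [M] acts nontrivially on some factor [L l] with [l] below
    [i]; then [j] is below [l], hence below [i], against the degrees. *)
Lemma factors_below_kill i j (M : lmodType A) :
  finite_length M -> factors_below L le i M -> (deg j < deg i)%N ->
  forall x : M, e j *: x = 0.
Proof.
move=> lM fM ji x; apply/eqP/contraT => /eqP ex.
have [m [F FF]] := finite_length_filtered lM; have [_ _ _ FC] := FF.
have [t tm [y ey]] := filtration_factor FF (idem j) ex.
have [l li iso] : exists2 l, le l i & lmod_iso (subquot (F t.+1) (F t)) (L l).
  by apply: fM; exists m, F; split=> //; exists t => //; exact: iso_refl.
have [sl [z hz]] := L_simple l.
have jl : le j l.
  apply/negPn/negP => jl; apply: ey.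
  exact: iso_scale0 (iso_sym iso) (weights_simple sl hz jl) y.
have := le_trans jl li; rewrite /le /reedy_le ltnNge (ltnW ji) orbF.
by move=> /eqP jE; rewrite jE ltnn in ji.
Qed.

(** * The filtration of [A eps] by standard modules *)

Section DeltaFiltration.
Variables (i : 'I_n.+1) (eps : A).
Hypothesis eps_idem : eps * eps = eps.

Fact layer_closed d : submod_closed
  [in ([set x | x * eps = x /\ trace_ideal d x] : set (A : nzRingType)^o)].
Proof.
apply: submoduleP => [|a x y [xe Jx] [ye Jy]].
  by split; [rewrite mul0r | exact: trace_ideal0].
split; first by rewrite mulrDl ye -mulrA xe.
by apply: trace_idealD => //; exact: trace_ideal_mull.
Qed.
(** This is [A_{<d} eps], kept inside the regular module so that all layers share one ambient
    module. *)
Definition layer d : submodule (A : nzRingType)^o := Submodule (layer_closed d).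

(* U is spanned by [layer d] and the A e_l g with (l, g) in s. *)
Definition spanned d (s : seq ('I_n.+1 * A)) (U : submodule (A : nzRingType)^o) :=
  [/\ forall x, layer d x -> U x, forall x, U x -> layer d.+1 x,
      forall p, p \in s -> deg p.1 = d /\ U (e p.1 * p.2)
    & forall x, U x -> exists2 r : seq ('I_n.+1 * A * A),
        [seq (p.1.1, p.2) | p <- r] = s & layer d (x - msum r)].

Section Step.
Variables (d : nat) (s : seq ('I_n.+1 * A)) (U : submodule (A : nzRingType)^o).
Hypothesis spU : spanned d s U.
Variables (l : 'I_n.+1) (g : A).
Hypotheses (dl : deg l = d) (eg : e l * g = g) (ge : g * eps = g) (Ug : ~ U g).

(** Choose a functional that vanishes on [U] and on [A_{<d}] and takes the value [1] at [g].
    Contracting the relation [a e_l g = msum r] modulo [A_{<d}] with it, by [her_inj], kills the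
    terms of [r] and leaves [a e_l]. *)
Lemma spanned_inj a : U (a * e l * g) -> trace_ideal d (a * e l).
Proof.
have [dU Ud sU genU] := spU.
move=> /genU[r rs Jr].
have [WU WUE] := vspace_of_submodule U.
have [WJ WJE] := vspace_of_submodule (trace_lideal d).
(* If [g = j + u], right multiplication by [eps] fixes [g] and [u] and moves [j] into [layer d],
   hence into [U]. *)
have gW : g \notin (WJ + WU)%VS.
  apply/negP => /memv_addP[j /WJE Jj [u /WUE Uu gE]]; apply: Ug.
  have [ue _] := Ud _ Uu; rewrite -ge gE mulrDl ue.
  apply: submodule_add Uu; apply: dU; split; first by rewrite -mulrA eps_idem.
  exact: trace_ideal_mulr.
have [f [flin f0 fg]] := separating_functional gW.
have fJ x : trace_ideal d x -> f x = 0.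
  by move=> Jx; apply: f0; rewrite -[x]addr0 memv_add ?mem0v //; apply/WJE.
have fU x : U x -> f x = 0.
  by move=> Ux; apply: f0; rewrite -[x]add0r memv_add ?mem0v //; apply/WUE.
pose r' := (l, a, g) :: [seq (p.1.1, - p.1.2, p.2) | p <- r].
have rP p : p \in r -> deg p.1.1 = d /\ U (e p.1.1 * p.2).
  by move=> pr; apply: (sU (p.1.1, p.2)); rewrite -rs;
     exact: (map_f (fun p => (p.1.1, p.2))).
have msum_r' : msum r' = a * e l * g - msum r.
  rewrite /msum big_cons big_map -sumrN; congr (_ + _).
  by apply: eq_bigr => p _; rewrite /= !mulNr.
have := her_inj her (d := d) (r := r') (f := f) l.
rewrite msum_r' big_cons /= eqxx eg fg scale1r big_map /=.
move=> H; have {H} := H _ (proj2 Jr) flin fJ.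
rewrite dl eqxx all_map /= big_seq_cond big1 ?addr0; last first.
  by move=> p /andP[/rP[_ Up] /eqP pl]; rewrite -pl fU // scale0r.
by apply; apply/allP => p /rP[/= ->].
Qed.

(** [U'] is [U + A g]. Right multiplication by [g] maps [A e_l] onto [U' / U], and [spanned_inj]
    identifies its kernel with [A_{<d} e_l]. *)
Lemma spanned_step : exists U' : submodule (A : nzRingType)^o,
  [/\ spanned d ((l, g) :: s) U', forall x, U x -> U' x, U' g
    & lmod_iso (subquot U' U) (Delta l)].
Proof.
have [dU Ud sU genU] := spU.
have cU' : submod_closed
    [in ([set x | exists a, U (x - a * g)] : set (A : nzRingType)^o)].
  apply: submoduleP => [|a x y [b Ux] [c Uy]].
    by exists 0; rewrite mul0r subr0; exact: submodule0.
  exists (a * b + c); rewrite mulrDl opprD addrACA -mulrA -mulrBr.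
  exact: (submoduleD a Ux Uy).
pose U' := Submodule cU'.
have UU' x : U x -> U' x by move=> Ux; exists 0; rewrite mul0r subr0.
have U'g a : U' (a * g) by exists a; rewrite subrr; exact: submodule0.
have U'g1 : U' g by exists 1; rewrite mul1r subrr; exact: submodule0.
have lg a : layer d.+1 (a * g).
  split; first by rewrite -mulrA ge.
  by rewrite -eg mulrA; apply: trace_ideal_mem; rewrite dl.
exists U'; split=> //; last first.
- rewrite /Delta dl; apply: iso_sym; pose h : {linear (A : nzRingType)^o ->
    (A : nzRingType)^o} := orbit_map (g : (A : nzRingType)^o).
  have hE x : h x = x * g by [].
  apply: (subquot_iso (h := h)) => [x _|y [a Uy]|x [a ->]].
  + exact: U'g.
  + by exists (a * e l); [exists a | rewrite hE -mulrA eg].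
  + rewrite hE; split; last exact: spanned_inj.
    move=> Jx; apply: dU; split; first by rewrite -mulrA ge.
    exact: trace_ideal_mulr.
split.
- by move=> x /dU/UU'.
- move=> x [a /Ud Ux]; rewrite -[x](subrK (a * g)).
  by rewrite -[X in X + _]mul1r; exact: (submoduleD 1 Ux (lg a)).
- move=> p; rewrite inE => /predU1P[->|/sU[-> /UU']//].
  by split; [exact: dl | rewrite [_ * _]eg].
- move=> x [a /genU[r rs rU]]; exists ((l, a, g) :: r); first by rewrite /= rs.
  by rewrite /msum big_cons /= -mulrA eg opprD addrA.
Qed.
End Step.

Definition is_Delta_above (X : lmodType A) : Prop :=
  exists2 j, le i j && (i != j) & lmod_iso X (Delta j).

(** Elements [e_l b eps] with [deg l = d] that are not yet in [U] are adjoined one by one. Each adds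
    a copy of [Delta l], and the bounded rank makes the process stop, at [layer d.+1]. *)
Lemma layer_filS d : (d < deg i)%N ->
  fil is_Delta_above (layer d) -> fil is_Delta_above (layer d.+1).
Proof.
move=> di fd; have [rk rkP] := finite_length_regular A.
have rk_le (U V : submodule (A : nzRingType)^o) :
    (forall x, U x -> V x) -> (rk U <= rk V)%N.
  move=> UV; have [/existsNP[x /not_implyP[Vx Ux]]|VU] :=
    pselect (~ forall x, V x -> U x).
    by apply: ltnW; apply: rkP => //; exists x.
  have -> // : U = V; apply: submodule_ext => x.
  by split; [exact: UV | move=> Vx; move/contrapT: VU; exact].
suff loop m : forall U s, spanned d s U -> fil is_Delta_above U ->
    (rk (layer d.+1) - rk U < m)%N -> fil is_Delta_above (layer d.+1).
  apply: (loop _ (layer d) [::] _ fd (ltnSn _)); split=> //.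
    by move=> x [xe Jx]; split=> //; exact: trace_ideal_mono Jx.
  by move=> x lx; exists [::] => //; rewrite /msum big_nil subr0.
elim: m => // m IHm U s spU fU rU; have [dU Ud sU genU] := spU.
have [all_in|/existsNP[l /existsNP[b /not_implyP[dl Ub]]]] :=
    pselect (forall l b, deg l = d -> U (e l * b * eps)).
  rewrite (_ : layer d.+1 = U) //; apply: submodule_ext => x; split; last exact: Ud.
  move=> [xe Jx]; rewrite -xe; move: x {xe} Jx; apply: trace_ideal_ind.
  - by rewrite mul0r; exact: submodule0.
  - by move=> x y Ux Uy; rewrite mulrDl; exact: (submodule_add Ux Uy).
  - move=> j a c; rewrite ltnS leq_eqVlt -!mulrA => /orP[/eqP dj|dj].
      by rewrite (mulrA (e j)); exact: (submoduleZ a (all_in _ c dj)).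
    apply: dU; split; first by rewrite -!mulrA eps_idem.
    by rewrite mulrA; exact: trace_ideal_mem.
have el : e l * (e l * b * eps) = e l * b * eps by rewrite !mulrA idem.
have ep : e l * b * eps * eps = e l * b * eps by rewrite -mulrA eps_idem.
have [U' [spU' UU' U'g iso]] := spanned_step spU dl el ep Ub.
apply: (IHm U' _ spU').
  apply: (FilS fU UU'); exists l => //; rewrite /le /reedy_le dl di orbT /=.
  by apply: contraTneq di => ->; rewrite dl ltnn.
have lt : (rk U < rk U')%N by apply: rkP => //; exists (e l * b * eps).
have [_ Ud' _ _] := spU'.
have le1 := rk_le _ _ Ud'.
by rewrite -ltnS (leq_trans _ rU) // ltnS ltn_sub2l // (leq_trans lt).
Qed.

(** [layer 0] vanishes because no degree is below [0]; the case [d = deg i] describes the kernel of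
    [A eps -> Delta i]. *)
Lemma layer_fil d : (d <= deg i)%N -> fil is_Delta_above (layer d).
Proof.
elim: d => [_|d IHd di]; last by apply: layer_filS => //; exact/IHd/ltnW.
by apply: Fil0 => x [_ [[|p r] // _ ->]]; rewrite /msum big_nil.
Qed.
End DeltaFiltration.

Record standard_datum i := StandardDatum {
  cover : lmodType A;
  cover_pi : {linear cover -> L i};
  cover_q : {linear cover -> Delta i};
  Delta_pi : {linear Delta i -> L i};
  standard_datumP :
    [/\ standard_data le cover_pi cover_q,
        forall x, Delta_pi (cover_q x) = cover_pi x,
        filtered (fun X => exists2 j, le j i && (j != i) & lmod_iso X (L j))
          (submod (ker Delta_pi))
      & filtered (is_Delta_above i) (submod (ker cover_q))]
}.

(** The cover is [A eps] for a minimal idempotent [eps] of [e_i A e_i] that does not kill a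
    generator of [L i]. [inhabited] is used because [eps] comes from an existence statement in
    [Prop]. *)
Lemma standard_exists i : inhabited (standard_datum i).
Proof.
have [sL [x hx]] := L_simple i; have [ex x0 _] := hx.
have eix0 : e i *: x <> 0 by rewrite ex.
have [eps [ee ie ei epsx epsmin]] := minimal_idempotent (idem i) eix0.
have epsP (y : (A : nzRingType)^o) : lideal eps y <-> y * eps = y :> A.
  by split=> [[a ->]|<-]; [rewrite -mulrA ee | exists y].
have Jx a : trace_ideal (deg i) a -> a *: x = 0.
  by move=> Ja; exact: highest_weight_kill hx _ Ja x.
pose P := submod (lideal eps).
pose gen_eps : P := sub_elt ((epsP eps).2 ee).
have genE (y : P) : y = (val y : A) *: gen_eps.
  by apply: val_inj; exact/esym/epsP/(submod_val_in y).
have p_lin : linear (fun y : P => (val y : A) *: x).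
  by move=> a y z; rewrite scalerDl -scalerA.
pose p : {linear P -> L i} :=
  HB.pack (fun y : P => (val y : A) *: x) (GRing.isLinear.Build A P (L i) _ _ p_lin).
have q_mem (y : P) : lideal (e i) (val y).
  apply/lideal_idemP; have /epsP <- := submod_val_in y.
  by rewrite -mulrA ei.
have q_lin : linear (fun y : P => subquot_pi (trace_lideal (deg i)) (q_mem y) : Delta i).
  move=> a y z; rewrite subquot_piZ -[RHS]quotmod_piD.
  by congr quotmod_pi; exact: val_inj.
pose q : {linear P -> Delta i} := HB.pack
  (fun y : P => subquot_pi (trace_lideal (deg i)) (q_mem y) : Delta i)
  (GRing.isLinear.Build A P (Delta i) _ _ q_lin).
have [r rE] : exists r : {linear Delta i -> L i}, forall y (Vy : lideal (e i) y),
    r (subquot_pi _ Vy) = (y : A) *: x.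
  have h_lin : linear (fun y : submod (lideal (e i)) => (val y : A) *: x).
    by move=> a y z; rewrite scalerDl -scalerA.
  pose h : {linear submod (lideal (e i)) -> L i} := HB.pack
    (fun y : submod (lideal (e i)) => (val y : A) *: x)
    (GRing.isLinear.Build A _ (L i) _ _ h_lin).
  have [r rE] := @quot_lift _ _ _ (restr (lideal (e i)) (trace_lideal (deg i))) h
    (fun y => @Jx (val y)).
  by exists r => y Vy; exact: rE.
(* Modulo [A_{<deg i}], [eps] is a multiple of [e_i], and a nonzero one since it does not kill [x];
   therefore [A eps] still surjects onto [Delta i]. *)
have [c Jc] := her_diag her i eps.
rewrite ie ei in Jc.
have c0 : c != 0.
  apply/eqP => c0; apply: epsx; apply: Jx.
  by rewrite -[eps]subr0 -(scale0r (e i)) -c0.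
have p_surj : surj p.
  move=> y; have [a <-] := simple_gen sL epsx y.
  by exists (a *: gen_eps); rewrite /= -scalerA.
apply: inhabits; apply: (@StandardDatum i P p q r); split.
- split.
  + split=> // [M N g f sg|U superfl].
      have [m gm] := sg (f gen_eps).
      have h_lin : linear (fun y : P => (val y : A) *: m).
        by move=> a y z; rewrite scalerDl -scalerA.
      pose h : {linear P -> M} := HB.pack (fun y : P => (val y : A) *: m)
        (GRing.isLinear.Build A P M _ _ h_lin).
      by exists h => y; rewrite /= linearZ gm -linearZ -genE.
    have [u [v [Uu pv uv]]] := superfl gen_eps.
    have ue : val u * eps = val u := (epsP _).1 (submod_val_in u).
    have ux : (val u : A) *: x = eps *: x.
      by have := congr1 p uv; rewrite linearD pv addr0 => /esym; exact.
    have [||||f [b [fu ff fe ef fx]]] := @fitting_idempotent _ _ _ x eps (eps * val u) ee.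
    + by rewrite mulrA ee.
    + by rewrite -mulrA ue.
    + exact: epsx.
    + by rewrite -scalerA ux scalerA ee.
    have [a aE] := epsmin f ff fe ef fx.
    move=> y; rewrite (genE y); apply: submoduleZ.
    have -> : gen_eps = (a * b * eps) *: u; last exact: submoduleZ.
    by apply: val_inj; rewrite /= -[RHS]/(a * b * eps * val u) [LHS]aE fu !mulrA.
  + move=> z; have [y [Vy ->]] := subquot_piP z.
    have yi := (lideal_idemP i y).1 Vy.
    exists (((c^-1%:A * y) : A) *: gen_eps); apply/subquot_pi_eq.
    rewrite /= -[_ *: _]/(c^-1%:A * y * eps).
    have -> : c^-1%:A * y * eps - y = c^-1%:A * y * (eps - c *: e i).
      rewrite mulrBr; congr (_ - _); rewrite mulr_algl -scalerAl -scalerAr yi.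
      by rewrite scalerA mulVf // scale1r.
    exact: trace_ideal_mull.
  + exact: factors_below_Delta.
  (* [Delta i] is the largest admissible quotient: by [factors_below_kill], any other one is
     annihilated by [A_{<deg i}]. *)
  + move=> U fU y qy; rewrite (genE y).
    have /subquot_pi0 Jy : q y = 0 := qy.
    move: (val y) Jy; apply: trace_ideal_ind.
    * by rewrite scale0r; exact: submodule0.
    * by move=> a b Ua Ub; rewrite scalerDl; exact: submodule_add.
    * move=> j a b ji; rewrite -!scalerA; apply: submoduleZ.
      have : e j *: quotmod_pi U (b *: gen_eps) = 0.
        apply: factors_below_kill fU ji _.
        apply: finite_length_quot; apply: finite_length_sub.
        exact: finite_length_regular.
      have : U (e j *: (b *: gen_eps)) <-> quotmod_pi U (e j *: (b *: gen_eps)) = 0.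
        by rewrite -[0](linear0 (quotmod_pi U)) quotmod_piE subr0.
      by rewrite linearZ => /iffRL.
- by move=> y; rewrite /= rE.
- have lK : finite_length (submod (ker r))
    by do !apply: finite_length_sub; apply: finite_length_quot;
    apply: finite_length_sub; exact: finite_length_regular.
  have [m [F [F0 Fm Fs FC]]] := finite_length_filtered lK.
  exists m, F; split=> // t tm; have [_ _ Lall] := L_complete.
  have [j iso] := Lall _ (FC t tm); exists j => //.
  have alive : ~ forall y : submod (ker r), e j *: y = 0.
    by move=> dead; apply: (L_alive iso); exact: subquot_scale0.
  apply/andP; split.
    apply/negPn/negP => ji; apply: alive => y; apply: val_inj.
    exact: weights_Delta ji (val y).
  (* [L i] does not occur in the kernel, since [e_i] kills it: if [z x = 0], the scalar by which
     [e_i z e_i] acts on [x] is zero, so [e_i z] lies in [A_{<deg i}]. *)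
  apply/eqP => jE; apply: alive => y; apply: val_inj; rewrite jE.
  have ry : r (val y) = 0 := submod_val_in y.
  have [z [Vz yz]] := subquot_piP (val y); rewrite submod_valZ yz subquot_piZ.
  apply/subquot_pi0.
  have zi := (lideal_idemP i z).1 Vz.
  have [a Ja] := her_diag her i z.
  move: ry; rewrite yz rE => zx.
  have : (e i * z * e i) *: x = 0 by rewrite -!scalerA ex zx scaler0.
  have := Jx _ Ja; rewrite scalerBl => /eqP; rewrite subr_eq0 => /eqP -> .
  rewrite -[a *: e i]mulr_algl -scalerA ex => /(kscale_eq0) /(_ x0) a0.
  by move: Ja; rewrite a0 scale0r subr0 -mulrA zi.
- have i_lin : linear (fun y : submod (ker q) => val (val y) : (A : nzRingType)^o).
    by move=> a y z; rewrite !submod_valD !submod_valZ.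
  pose h : {linear submod (ker q) -> (A : nzRingType)^o} := HB.pack
    (fun y : submod (ker q) => val (val y) : (A : nzRingType)^o)
    (GRing.isLinear.Build A _ (A : nzRingType)^o _ _ i_lin).
  (* Viewed inside [A], the kernel of [q] is exactly [layer (deg i)]. *)
  apply: (fil_filtered (h := h)) (layer_fil ee (leqnn (deg i))).
  + move=> X Y XY [j ij Xj]; exists j => //; apply: iso_trans Xj; exact: iso_sym.
  + by move=> y z /= /val_inj /val_inj.
  + move=> y; split=> [[ye Jy]|[z <-]].
      have Vy : lideal eps y by apply/epsP.
      have qy : ker q (sub_elt Vy) by apply/subquot_pi0.
      by exists (sub_elt qy).
    have qz : q (val z) = 0 := submod_val_in z.
    split; first exact: (epsP _).1 (submod_val_in (val z)).
    by move/subquot_pi0: qz.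
Qed.

Theorem heredity_quasi_hereditary : quasi_hereditary L le.
Proof.
split; [by move=> i; rewrite /le /reedy_le eqxx | exact: le_anti | exact: le_trans
       | exact: L_complete |].
have datum i : standard_datum i by apply: inhabited_witness; exact: standard_exists.
exists (fun i => cover (datum i)), Delta, (fun i => cover_pi (datum i)),
  (fun i => cover_q (datum i)), (fun i => Delta_pi (datum i)) => i.
exact: standard_datumP.
Qed.

Lemma standard_module_Delta i D : standard_module L le i D -> lmod_iso D (Delta i).
Proof.
move=> [P [p [q std]]]; have [[P' p' q' r' [std' _ _ _]]] := standard_exists i.
exact: standard_data_unique std std'.
Qed.

End Simples.
End Heredity.

(** * The triangular decomposition of a Reedy algebra *)

Lemma tensor_lift0 (R : nzRingType) (X : zmodType) (ract : X -> R -> X)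
    (N : lmodType R) (V : zmodType) (phi : X -> N -> V) :
  balanced ract phi -> tensor_lift phi (0 : tensor ract N) = 0.
Proof.
move=> b; apply: (addrI (tensor_lift phi (0 : tensor ract N))).
by rewrite -tensor_liftD // !addr0.
Qed.

Lemma tensor_lift_sum (R : nzRingType) (X : zmodType) (ract : X -> R -> X)
    (N : lmodType R) (V : zmodType) (phi : X -> N -> V) (I : Type) (s : seq I)
    (P : pred I) (x : I -> X) (y : I -> N) :
  balanced ract phi ->
  tensor_lift phi (\sum_(i <- s | P i) tens ract (x i) (y i)) =
    \sum_(i <- s | P i) phi (x i) (y i).
Proof.
move=> b; rewrite (big_morph _ (tensor_liftD b) (tensor_lift0 b)).
by apply: eq_bigr => i _; exact: tensor_liftE.
Qed.

Section ReedyStructure.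
Variables (k : fieldType) (A : falgType k) (n : nat).
Variables (e : 'I_n.+1 -> A) (deg : 'I_n.+1 -> nat) (Ap Am : {aspace A}).
Hypothesis ry : reedy e deg Ap Am.

Let orth := reedy_orthogonal ry.

Lemma reedy_idem i : e i * e i = e i.
Proof. by rewrite orth eqxx. Qed.

Lemma peirceP (x y : A) (U : {vspace A}) (a : A) :
  a \in peirce x U y <-> exists2 u, u \in U & a = x * u * y.
Proof.
split=> [/memv_imgP[u Uu ->]|[u Uu ->]].
  by exists u => //; rewrite comp_lfunE !lfunE.
by apply/memv_imgP; exists u; rewrite // comp_lfunE !lfunE.
Qed.

Lemma peirce_line (U : {vspace A}) i : e i \in U ->
  \dim (peirce (e i) U (e i)) = 1%N ->
  forall u, u \in U -> exists c, e i * u * e i = c *: e i.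
Proof.
move=> eU d1 u Uu; apply/vlineP.
have en0 : e i != 0.
  apply/eqP => e0; suff : peirce (e i) U (e i) = 0%VS by move=> E; rewrite E dimv0 in d1.
  apply/eqP; rewrite -subv0; apply/subvP => y /peirceP[v _ ->].
  by rewrite e0 mulr0 memv0.
have ep : e i \in peirce (e i) U (e i).
  by apply/peirceP; exists (e i) => //; rewrite !reedy_idem.
have /eqP -> : (<[e i]> == peirce (e i) U (e i))%VS.
  by rewrite eqEdim d1 dim_vline en0 andbT -memvE.
by apply/peirceP; exists u.
Qed.

Lemma peirce_neq0 (U : {vspace A}) i j u : u \in U -> e j * u * e i <> 0 ->
  peirce (e j) U (e i) != 0%VS.
Proof.
move=> Uu u0; apply/eqP => p0; apply: u0.
have : e j * u * e i \in peirce (e j) U (e i) by apply/peirceP; exists u.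
by rewrite p0 memv0 => /eqP.
Qed.

Lemma plus_diag i u : u \in Ap -> exists c, e i * u * e i = c *: e i.
Proof. exact: peirce_line (reedy_memp ry i) (reedy_diagp ry i) u. Qed.

Lemma minus_diag i u : u \in Am -> exists c, e i * u * e i = c *: e i.
Proof. exact: peirce_line (reedy_memm ry i) (reedy_diagm ry i) u. Qed.

Lemma plus_off i j u : u \in Ap -> i != j -> (deg j <= deg i)%N -> e j * u * e i = 0.
Proof.
move=> uU ij ji; apply/eqP/contraT => /eqP /(peirce_neq0 uU) /(reedy_degp ry ij).
by rewrite ltnNge ji.
Qed.

Lemma minus_off i j u : u \in Am -> i != j -> (deg i <= deg j)%N -> e j * u * e i = 0.
Proof.
move=> uU ij ji; apply/eqP/contraT => /eqP /(peirce_neq0 uU) /(reedy_degm ry ij).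
by rewrite ltnNge ji.
Qed.

Definition split_sum (r : seq ('I_n.+1 * A * A)) :=
  all (fun p => (p.1.2 \in Ap) && (p.2 \in Am)) r.

Lemma sum_peirce (a : A) : a = \sum_j \sum_i e j * a * e i.
Proof.
under eq_bigr do rewrite -mulr_sumr (reedy_complete ry) mulr1.
by rewrite -mulr_suml (reedy_complete ry) mul1r.
Qed.

Lemma reedy_balanced j i l (V : zmodType) (phi : A -> A -> V) :
  (forall x y z, phi (x + y) z = phi x z + phi y z) ->
  (forall x y z, phi x (y + z) = phi x y + phi x z) ->
  (forall c x y, phi (c *: x) y = phi x (c *: y)) ->
  balanced (fun (x : subvs_of (peirce (e j) Ap (e l))) (c : k) => c *: x)
    (fun x (y : subvs_of (peirce (e l) Am (e i))) => phi (vsval x) (vsval y)).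
Proof. by move=> Dl Dr Z; split=> *; rewrite ?linearD ?linearZ /=. Qed.

Lemma mulr_reedy_balanced j i l :
  balanced (fun (x : subvs_of (peirce (e j) Ap (e l))) (c : k) => c *: x)
    (fun x (y : subvs_of (peirce (e l) Am (e i))) => vsval x * vsval y).
Proof.
apply: (@reedy_balanced j i l A *%R) => *; first exact: mulrDl.
  exact: mulrDr.
by rewrite -scalerAl -scalerAr.
Qed.

(** Surjectivity of multiplication, used in every corner [e_j A e_i] and summed over the corners. *)
Lemma split_sum_exists a : exists2 r, split_sum r & a = msum e r.
Proof.
pose Q a := exists2 r, split_sum r & a = msum e r.
have Q0 : Q 0 by exists [::] => //; rewrite /msum big_nil.
have QD x y : Q x -> Q y -> Q (x + y).
  move=> [r rr ->] [s ss ->]; exists (r ++ s); last by rewrite msum_cat.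
  by rewrite /split_sum all_cat; apply/andP.
rewrite -/(Q a) (sum_peirce a).
apply: (big_ind Q) => // j _; apply: (big_ind Q) => // i _.
have [t <-] : exists t, @reedy_mul _ A n e Ap Am j i t = e j * a * e i.
  by apply/(reedy_mul_im ry)/peirceP; exists a; rewrite ?memvf.
apply: (big_ind Q) => // l _.
have b := @mulr_reedy_balanced j i l.
elim/tensor_ind: (t l) => [x y||u v Qu Qv].
- rewrite tensor_liftE //.
  have /peirceP[u Uu ->] := subvsP x; have /peirceP[v Vv ->] := subvsP y.
  exists [:: (l, e j * u, v * e i)]; last first.
    rewrite /msum big_seq1 /= -!mulrA; congr (_ * (_ * _)).
    by rewrite mulrA reedy_idem.
  by rewrite /split_sum /= andbT !memvM ?(reedy_memp ry) ?(reedy_memm ry).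
- by rewrite tensor_lift0.
- by rewrite tensor_liftD //; exact: QD.
Qed.

Lemma sum_fibers (V : zmodType) (r : seq ('I_n.+1 * A * A))
    (F : 'I_n.+1 -> 'I_n.+1 * A * A -> V) :
  \sum_l \sum_(p <- r | p.1.1 == l) F l p = \sum_(p <- r) F p.1.1 p.
Proof.
rewrite [RHS](partition_big (fun p => p.1.1) xpredT) //=.
by apply: eq_bigr => l _; apply: eq_bigr => p /eqP ->.
Qed.

(** Cut into corners, the relation is sent to [0] by the injective multiplication map, so its
    component at each [l] is the zero tensor. [phi] factors through these tensor products, and
    summing over the corners gives back the uncut sum. *)
Lemma split_sum_contract (V : zmodType) (phi : A -> A -> V) r l :
  (forall x y z, phi (x + y) z = phi x z + phi y z) ->
  (forall x y z, phi x (y + z) = phi x y + phi x z) ->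
  (forall c x y, phi (c *: x) y = phi x (c *: y)) ->
  split_sum r -> msum e r = 0 ->
  \sum_(p <- r | p.1.1 == l) phi (p.1.2 * e l) (e l * p.2) = 0.
Proof.
move=> Dl Dr Z /allP rr r0.
have S1 (I : Type) (s : seq I) (F : I -> A) y :
    phi (\sum_(i <- s) F i) y = \sum_(i <- s) phi (F i) y.
  apply: (big_morph (fun x => phi x y)) => //.
  by apply: (addrI (phi 0 y)); rewrite -Dl !addr0.
have S2 (I : Type) (s : seq I) (F : I -> A) x :
    phi x (\sum_(i <- s) F i) = \sum_(i <- s) phi x (F i).
  apply: (big_morph (fun y => phi x y)) => //.
  by apply: (addrI (phi x 0)); rewrite -Dr !addr0.
pose X j l (p : 'I_n.+1 * A * A) := vsproj (peirce (e j) Ap (e l)) (e j * p.1.2 * e l).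
pose Y i l (p : 'I_n.+1 * A * A) := vsproj (peirce (e l) Am (e i)) (e l * p.2 * e i).
have XE j l' p : p \in r -> vsval (X j l' p) = e j * p.1.2 * e l'.
  by move=> /rr/andP[p1 _]; rewrite vsprojK //; apply/peirceP; exists p.1.2.
have YE i l' p : p \in r -> vsval (Y i l' p) = e l' * p.2 * e i.
  by move=> /rr/andP[_ p2]; rewrite vsprojK //; apply/peirceP; exists p.2.
have corner j i :
    \sum_(p <- r | p.1.1 == l) phi (e j * p.1.2 * e l) (e l * p.2 * e i) = 0.
  pose t l' : reedy_tensor e Ap Am j i l' :=
    \sum_(p <- r | p.1.1 == l') tens _ (X j l' p) (Y i l' p).
  have t0 : t = fun=> 0.
    apply: (reedy_mul_inj ry (i := i) (j := j)).
    rewrite /reedy_mul [RHS]big1; last first.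
      by move=> l' _; rewrite tensor_lift0 //; exact: mulr_reedy_balanced.
    transitivity (\sum_l' \sum_(p <- r | p.1.1 == l')
        e j * (p.1.2 * e l' * p.2) * e i); last first.
      rewrite sum_fibers -mulr_suml -mulr_sumr.
      by move: r0; rewrite /msum => ->; rewrite mulr0 mul0r.
    apply: eq_bigr => l' _.
    rewrite /t tensor_lift_sum; last exact: mulr_reedy_balanced.
    rewrite big_seq_cond [RHS]big_seq_cond.
    apply: eq_bigr => p /andP[pr _]; rewrite XE // YE // -!mulrA.
    by congr (_ * (_ * _)); rewrite mulrA reedy_idem.
  have b := @reedy_balanced j i l _ phi Dl Dr Z.
  have := tensor_lift_sum r (fun p => p.1.1 == l) (X j l) (Y i l) b.
  rewrite -/(t l) t0 tensor_lift0 // => /esym.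
  rewrite big_seq_cond => E; rewrite big_seq_cond -[RHS]E.
  by apply: eq_bigr => p /andP[pr _]; rewrite XE // YE.
transitivity (\sum_j \sum_i \sum_(p <- r | p.1.1 == l)
   phi (e j * p.1.2 * e l) (e l * p.2 * e i)); last first.
  by rewrite big1 // => j _; rewrite big1 // => i _; exact: corner.
under [RHS]eq_bigr do rewrite exchange_big /=.
rewrite exchange_big /=; apply: eq_bigr => p _.
under eq_bigr do rewrite -S2 -mulr_sumr (reedy_complete ry) mulr1.
by rewrite -S1 -!mulr_suml (reedy_complete ry) mul1r.
Qed.

(** Projection of [A] to its summand [A^+ e_l (x) e_l A^-], followed by [phi]. It is evaluated on a
    chosen decomposition; [split_sum_contract] makes the choice irrelevant. *)
Lemma split_component (V : zmodType) (phi : A -> A -> V) l :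
  (forall x y z, phi (x + y) z = phi x z + phi y z) ->
  (forall x y z, phi x (y + z) = phi x y + phi x z) ->
  (forall c x y, phi (c *: x) y = phi x (c *: y)) ->
  exists T : A -> V, forall r, split_sum r ->
    T (msum e r) = \sum_(p <- r | p.1.1 == l) phi (p.1.2 * e l) (e l * p.2).
Proof.
move=> Dl Dr Z.
pose rep a := s2val (cid2 (split_sum_exists a)).
have repP a : split_sum (rep a) := s2valP (cid2 (split_sum_exists a)).
have repE a : a = msum e (rep a) := s2valP' (cid2 (split_sum_exists a)).
pose F r := \sum_(p <- r | p.1.1 == l) phi (p.1.2 * e l) (e l * p.2).
exists (fun a => F (rep a)) => r rr; apply/eqP; rewrite -subr_eq0; apply/eqP.
pose s := rep (msum e r).
have N x y : phi (- x) y = - phi x y.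
  apply: (addrI (phi x y)); rewrite -Dl !subrr.
  by apply: (addrI (phi 0 y)); rewrite -Dl !addr0.
have := @split_sum_contract _ phi (s ++ [seq (p.1.1, - p.1.2, p.2) | p <- r]) l Dl Dr Z.
rewrite big_cat big_map /= => H; rewrite /F -/s -sumrN -[RHS]H; first last.
- rewrite msum_cat -repE /msum big_map -[X in X + _]/(msum e r).
  rewrite -[RHS](subrr (msum e r)); congr (_ + _); rewrite /msum -sumrN.
  by apply: eq_bigr => p _; rewrite /= !mulNr.
- rewrite /split_sum all_cat [all _ s]repP all_map.
  by apply/allP => p /(allP rr) /=; rewrite memvN.
- by congr (_ + _); apply: eq_bigr => p _; rewrite /= mulNr N.
Qed.

Lemma split_sum_cat r s : split_sum (r ++ s) = split_sum r && split_sum s.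
Proof. exact: all_cat. Qed.

(** The sum of the [A^+ e_l A^-] with [deg l < d], a priori smaller than [A_{<d}]. *)
Definition split_below d x :=
  exists r, [/\ split_sum r, all (fun p => deg p.1.1 < d)%N r & x = msum e r].

Lemma split_below0 d : split_below d 0.
Proof. by exists [::]; rewrite /msum big_nil. Qed.

Lemma split_belowD d x y : split_below d x -> split_below d y -> split_below d (x + y).
Proof.
move=> [r [rr dr ->]] [s [ss ds ->]]; exists (r ++ s).
by rewrite split_sum_cat rr ss all_cat dr ds msum_cat.
Qed.

Lemma split_below_sum d (I : eqType) (s : seq I) (F : I -> A) :
  (forall i, i \in s -> split_below d (F i)) -> split_below d (\sum_(i <- s) F i).
Proof.
move=> QF; rewrite big_seq; apply: big_ind => //; first exact: split_below0.
exact: split_belowD.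
Qed.

Lemma split_below_mull d a x : a \in Ap -> split_below d x -> split_below d (a * x).
Proof.
move=> aA [r [rr dr ->]]; exists [seq (p.1.1, a * p.1.2, p.2) | p <- r].
split; last by rewrite msum_mull.
  by rewrite /split_sum all_map; apply/allP => p /(allP rr) /andP[p1 p2] /=;
     rewrite memvM.
by rewrite all_map.
Qed.

Lemma split_below_mono d d' x : (d <= d')%N -> split_below d x -> split_below d' x.
Proof.
move=> dd [r [rr dr ->]]; exists r; split=> //.
by apply/allP => p /(allP dr) /leq_trans; exact.
Qed.

Lemma split_below_term d l a b : a \in Ap -> b \in Am -> (deg l < d)%N ->
  split_below d (a * e l * b).
Proof.
move=> aA bA ld; exists [:: (l, a, b)].
by rewrite /split_sum /= aA bA ld /msum big_seq1.
Qed.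

(** In a decomposition of [b], a term through [e_m] survives left multiplication by [e_l] only if
    [m = l] or [deg m < deg l], because of the degree condition on [A^+]. *)
Lemma split_below_idem_mull l b : split_below (deg l).+1 (e l * b).
Proof.
have [r /allP rr ->] := split_sum_exists b; rewrite /msum mulr_sumr.
apply: split_below_sum => p /rr /andP[p1 p2].
have [lt|lt] := ltnP (deg p.1.1) (deg l).+1.
  by rewrite !mulrA; apply: split_below_term; rewrite ?memvM ?(reedy_memp ry).
rewrite !mulrA plus_off ?mul0r //; first exact: split_below0.
  by apply: contraTneq lt => ->; rewrite ltnn.
exact: ltnW.
Qed.

(** In [a e_j b], decompose [a]: the condition on [A^-] leaves only terms through [e_m] with
    [deg m <= deg j], and what stands to the right of [e_m] straightens without raising the
    degree. *)
Lemma trace_ideal_split d x : trace_ideal e deg d x -> split_below d x.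
Proof.
apply: trace_ideal_ind; [exact: split_below0 | exact: split_belowD | move=> j a b jd].
have [r /allP rr ->] := split_sum_exists a; rewrite /msum !mulr_suml.
apply: split_below_sum => p /rr /andP[p1 p2].
have [lt|lt] := ltnP (deg p.1.1) (deg j).+1.
  rewrite -!mulrA; apply: split_below_mull => //.
  by apply: split_below_mono (split_below_idem_mull _ _); exact: leq_trans lt jd.
rewrite -!mulrA (mulrA p.2) 2!(mulrA (e p.1.1)) minus_off ?mul0r ?mulr0 //.
- exact: split_below0.
- by apply: contraTneq lt => ->; rewrite ltnn.
- exact: ltnW.
Qed.

(** In a decomposition of [a], terms through [e_l] contribute scalars from [e_l A^- e_l]; the others
    are killed by [e_l] or pass through a smaller degree. *)
Lemma plus_reduce l a :
  exists2 x, x \in Ap & trace_ideal e deg (deg l) ((a - x) * e l).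
Proof.
have [r /allP rr ->] := split_sum_exists a.
have key p : p \in r -> exists2 x, x \in Ap &
    trace_ideal e deg (deg l) ((p.1.2 * e p.1.1 * p.2 - x) * e l).
  move=> /rr /andP[p1 p2]; have [pl|pl] := eqVneq p.1.1 l.
    have [c cE] := minus_diag l p2.
    exists (c *: p.1.2); first by rewrite memvZ.
    rewrite mulrBl pl -!mulrA (mulrA (e l)) cE -scalerAr -scalerAl subrr.
    exact: trace_ideal0.
  exists 0; rewrite ?mem0v // subr0.
  have [lt|le] := ltnP (deg p.1.1) (deg l).
    by rewrite -(mulrA _ p.2); exact: trace_ideal_mem.
  rewrite -!mulrA (mulrA (e p.1.1)) minus_off // ?mulr0; first exact: trace_ideal0.
  by rewrite eq_sym.
rewrite /msum; elim: r {rr} key => [|p r IHr] key.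
  exists 0; rewrite ?mem0v // big_nil subr0 mul0r; exact: trace_ideal0.
have [x xA Jx] := key p (mem_head _ _).
have [y yA Jy] := IHr (fun q qr => key q (mem_behead (s := p :: r) qr)).
exists (x + y); first exact: memvD.
by rewrite big_cons opprD addrACA mulrDl; exact: trace_idealD.
Qed.

Lemma minus_reduce l b :
  exists2 y, y \in Am & trace_ideal e deg (deg l) (e l * (b - y)).
Proof.
have [r /allP rr ->] := split_sum_exists b.
have key p : p \in r -> exists2 y, y \in Am &
    trace_ideal e deg (deg l) (e l * (p.1.2 * e p.1.1 * p.2 - y)).
  move=> /rr /andP[p1 p2]; have [pl|pl] := eqVneq p.1.1 l.
    have [c cE] := plus_diag l p1.
    exists (c *: p.2); first by rewrite memvZ.
    rewrite mulrBr pl !mulrA cE -scalerAr -scalerAl subrr.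
    exact: trace_ideal0.
  exists 0; rewrite ?mem0v // subr0.
  have [lt|le] := ltnP (deg p.1.1) (deg l).
    by rewrite !mulrA; exact: trace_ideal_mem.
  by rewrite !mulrA plus_off // ?mul0r; exact: trace_ideal0.
rewrite /msum; elim: r {rr} key => [|p r IHr] key.
  exists 0; rewrite ?mem0v // big_nil subr0 mulr0; exact: trace_ideal0.
have [x xA Jx] := key p (mem_head _ _).
have [y yA Jy] := IHr (fun q qr => key q (mem_behead (s := p :: r) qr)).
exists (x + y); first exact: memvD.
by rewrite big_cons opprD addrACA mulrDr; exact: trace_idealD.
Qed.

(* T contracts the component of a in A^+ e_l (x) e_l A^- on the right by f. *)
Lemma split_contract_right (f : A -> k) l :
  (forall c x y, f (c *: x + y) = c * f x + f y) ->
  exists T : A -> A, forall r, split_sum r ->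
    T (msum e r) = \sum_(p <- r | p.1.1 == l) f (e l * p.2) *: (p.1.2 * e l).
Proof.
move=> flin; have [_ fD _ fZ] := functionalE flin.
apply: (@split_component _ (fun x y => f y *: x)) => [x y z|x y z|c x y].
- exact: scalerDr.
- by rewrite fD scalerDl.
- by rewrite fZ scalerA mulrC.
Qed.

Theorem reedy_heredity : heredity e deg.
Proof.
split.
- exact: orth.
- exact: reedy_complete ry.
- move=> i j a ji dji; have [x xA Jx] := plus_reduce i a.
  have := trace_ideal_mull (e j) Jx.
  have x0 : e j * x * e i = 0 by rewrite plus_off ?dji // eq_sym.
  by rewrite mulrA mulrBr mulrBl x0 subr0.
- move=> i a; have [x xA Jx] := plus_reduce i a; have [c cE] := plus_diag i xA.
  by exists c; have := trace_ideal_mull (e i) Jx; rewrite mulrA mulrBr mulrBl cE.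
- move=> d r f l dr Jr flin fJ.
  have [_ _ fB _] := functionalE flin.
  pose xx (p : 'I_n.+1 * A * A) := s2val (cid2 (plus_reduce p.1.1 p.1.2)).
  pose yy (p : 'I_n.+1 * A * A) := s2val (cid2 (minus_reduce p.1.1 p.2)).
  have xA p : xx p \in Ap := s2valP (cid2 (plus_reduce p.1.1 p.1.2)).
  have yA p : yy p \in Am := s2valP (cid2 (minus_reduce p.1.1 p.2)).
  have xJ p : p \in r -> trace_ideal e deg d ((p.1.2 - xx p) * e p.1.1).
    by move=> /(allP dr)/eqP <-; exact: s2valP' (cid2 (plus_reduce p.1.1 p.1.2)).
  have yJ p : p \in r -> trace_ideal e deg d (e p.1.1 * (p.2 - yy p)).
    by move=> /(allP dr)/eqP <-; exact: s2valP' (cid2 (minus_reduce p.1.1 p.2)).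
  pose r' := [seq (p.1.1, xx p, yy p) | p <- r].
  have J' : trace_ideal e deg d (msum e r').
    rewrite -[msum e r'](subKr (msum e r)); apply: trace_idealB => //.
    rewrite /msum big_map -sumrB big_seq; apply: trace_ideal_sum => p pr /=.
    have -> : p.1.2 * e p.1.1 * p.2 - xx p * e p.1.1 * yy p =
        (p.1.2 - xx p) * e p.1.1 * p.2 + xx p * (e p.1.1 * (p.2 - yy p)).
      by rewrite !mulrBl !mulrBr !mulrA addrA subrK.
    apply: trace_idealD; first by apply: trace_ideal_mulr; exact: xJ.
    by apply: trace_ideal_mull; exact: yJ.
  have [s [ss ds E]] := trace_ideal_split J'.
  have rr' : split_sum r'.
    by rewrite /split_sum all_map; apply/allP => p _ /=; rewrite xA yA.
  have [T TE] := split_contract_right l flin.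
  have [ld|ld] := eqVneq (deg l) d; last first.
    rewrite big_seq_cond big1; first exact: trace_ideal0.
    by move=> p /andP[/(allP dr)/eqP pd /eqP pl]; rewrite -pd pl eqxx in ld.
  (* The reduced sum only passes through degree [d], but lies in [A_{<d}] and so also decomposes
     through smaller degrees. Uniqueness makes its contraction at [l] vanish exactly. *)
  have T0 : \sum_(p <- r' | p.1.1 == l) f (e l * p.2) *: (p.1.2 * e l) = 0.
    rewrite -TE // E TE // big_seq_cond big1 // => p /andP[/(allP ds) pd /eqP pl].
    by rewrite pl ld ltnn in pd.
  rewrite -[X in trace_ideal _ _ _ X]subr0 -[X in _ - X]T0 big_map /= -sumrB.
  rewrite big_seq_cond; apply: trace_ideal_sum => p /andP[pr /eqP pl].
  have -> : f (e l * p.2) = f (e l * yy p).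
    apply/eqP; rewrite -subr_eq0 -fB -mulrBr -pl; apply/eqP/fJ; exact: yJ.
  rewrite -scalerBr -mulrBl -pl; apply: trace_idealZ; exact: xJ.
Qed.

End ReedyStructure.

(** * The subalgebra A^- and induction *)

Section Minus.
Variables (k : fieldType) (A : falgType k) (n : nat).
Variables (e : 'I_n.+1 -> A) (deg : 'I_n.+1 -> nat) (Ap Am : {aspace A}).
Hypothesis ry : reedy e deg Ap Am.

Local Notation B := (subvs_of Am).
Definition eminus i : B := vsproj Am (e i).

Lemma vsval_eminus i : vsval (eminus i) = e i.
Proof. by rewrite vsprojK // (reedy_memm ry). Qed.

Lemma minus1 : 1 \in Am.
Proof.
by rewrite -(reedy_complete ry) memv_suml // => i _; exact: reedy_memm ry i.
Qed.

Lemma vsvalM (x y : B) : vsval (x * y) = vsval x * vsval y. Proof. by []. Qed.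
Lemma vsval1 : vsval (1 : B) = 1.
Proof. by apply/eqP; rewrite [_ == _]algid_eq1 minus1. Qed.

Lemma eminus_orth i j : eminus i * eminus j = if i == j then eminus i else 0.
Proof.
apply: subvs_inj; rewrite vsvalM !vsval_eminus (reedy_orthogonal ry).
by case: ifP; rewrite ?vsval_eminus.
Qed.

Lemma eminus_complete : \sum_i eminus i = 1.
Proof.
apply: subvs_inj; rewrite [RHS]vsval1 -(reedy_complete ry) linear_sum.
by apply: eq_bigr => i _; exact: vsval_eminus.
Qed.

Lemma eminus_off i j (b : B) : j != i -> (deg i <= deg j)%N ->
  eminus j * b * eminus i = 0.
Proof.
move=> ji dij; apply: subvs_inj; rewrite !vsvalM !vsval_eminus (minus_off ry) ?subvsP //.
by rewrite eq_sym.
Qed.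

Lemma eminus_diag i (b : B) : exists c, eminus i * b * eminus i = c *: eminus i.
Proof.
have [c cE] := minus_diag ry i (subvsP b); exists c.
by apply: subvs_inj; rewrite !vsvalM linearZ /= !vsval_eminus.
Qed.

(** Counterpart of [plus_reduce] with the span of the [e_i] in the role of [A^+]. *)
Lemma eminus_reduce i (b : B) :
  exists c, trace_ideal eminus deg (deg i) (b * eminus i - c *: eminus i).
Proof.
have [c cE] := eminus_diag i b; exists c.
have -> : b * eminus i = \sum_j eminus j * b * eminus i.
  by rewrite -!mulr_suml eminus_complete mul1r.
rewrite (bigD1 i) //= cE addrAC subrr add0r; apply: trace_ideal_sum => j ji.
have [lt|le] := ltnP (deg j) (deg i).
  by rewrite -[eminus j]mul1r -mulrA; exact: trace_ideal_mem.
by rewrite eminus_off //; exact: trace_ideal0.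
Qed.

Theorem minus_heredity : heredity eminus deg.
Proof.
split.
- exact: eminus_orth.
- exact: eminus_complete.
- by move=> i j b ji dji; rewrite eminus_off ?dji //; exact: trace_ideal0.
- by move=> i b; have [c ->] := eminus_diag i b; exists c; rewrite subrr;
     exact: trace_ideal0.
- move=> d r f l /allP dr Jr flin fJ.
  have [f0 fD fB fZ] := functionalE flin.
  have [ld|ld] := eqVneq (deg l) d; last first.
    rewrite big_seq_cond big1; first exact: trace_ideal0.
    by move=> p /andP[/dr/eqP pd /eqP pl]; rewrite -pd pl eqxx in ld.
  pose c (p : 'I_n.+1 * B * B) := projT1 (cid (eminus_reduce p.1.1 p.1.2)).
  have cJ p : p \in r ->
      trace_ideal eminus deg d (p.1.2 * eminus p.1.1 - c p *: eminus p.1.1).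
    by move=> /dr/eqP <-; exact: projT2 (cid (eminus_reduce p.1.1 p.1.2)).
  (* Left factors being scalars [c p] modulo the ideal, the contraction is [e_l] times this sum,
     which vanishes because [f] kills the ideal. *)
  have sumc : \sum_(p <- r | p.1.1 == l) c p * f (eminus l * p.2) = 0.
    have Jc : trace_ideal eminus deg d (\sum_(p <- r) c p *: (eminus p.1.1 * p.2)).
      rewrite -[\sum_(p <- r) c p *: _](subKr (msum eminus r)); apply: trace_idealB => //.
      rewrite /msum -sumrB big_seq; apply: trace_ideal_sum => p pr.
      by rewrite scalerAl -mulrBl; apply: trace_ideal_mulr; exact: cJ.
    have := fJ _ (trace_ideal_mull (eminus l) Jc).
    rewrite mulr_sumr (bigID (fun p => p.1.1 == l)) /=.
    rewrite [X in _ + X]big1 ?addr0; last first.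
      move=> p pl; rewrite -scalerAr mulrA eminus_orth eq_sym (negPf pl).
      by rewrite mul0r scaler0.
    rewrite (big_morph f fD f0).
    move=> E; rewrite -[RHS]E; apply: eq_bigr => p /eqP ->.
    by rewrite -scalerAr mulrA eminus_orth eqxx fZ.
  have S0 : \sum_(p <- r | p.1.1 == l) f (eminus l * p.2) *: (c p *: eminus l) = 0.
    under eq_bigr do rewrite scalerA mulrC.
    by rewrite -scaler_suml sumc scale0r.
  rewrite -[X in trace_ideal _ _ _ X]subr0 -[X in _ - X]S0 -sumrB.
  rewrite big_seq_cond; apply: trace_ideal_sum => p /andP[pr /eqP pl].
  by rewrite -scalerBr; apply: trace_idealZ; have := cJ p pr; rewrite pl.
Qed.

(** * The simple and standard modules of [A^-] *)

Section MinusSimple.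
Variables (i : 'I_n.+1) (S : lmodType B) (q : {linear submod (lideal (eminus i)) -> S}).
Hypotheses (sS : simple S) (q_surj : surj q).

Fact eminus_lideal : lideal (eminus i) (eminus i : (B : nzRingType)^o).
Proof. by exists 1; rewrite mul1r. Qed.

Definition minus_gen : S := q (sub_elt eminus_lideal).

Lemma minus_gen_fix : eminus i *: minus_gen = minus_gen.
Proof.
rewrite -linearZ; congr (q _); apply: val_inj.
by rewrite /= -[LHS]/(eminus i * eminus i) eminus_orth eqxx.
Qed.

Lemma minus_gen_span y : exists b, b *: minus_gen = y.
Proof.
have [x <-] := q_surj y; have [b bE] := submod_val_in x; exists b.
by rewrite -linearZ; congr (q _); apply: val_inj; rewrite bE.
Qed.

Lemma minus_gen_neq0 : minus_gen <> 0.
Proof.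
move=> g0; have [[y y0] _] := sS; apply: y0.
by have [b <-] := minus_gen_span y; rewrite g0 scaler0.
Qed.

(** A nonzero [e_j y] would be reached from the generator and would in turn generate it, so the
    degree would have to drop both from [i] to [j] and from [j] to [i]. *)
Lemma minus_simple_weight j (y : S) : j != i -> eminus j *: y = 0.
Proof.
move=> ji; apply/eqP/contraT => /eqP ey.
have [b bE] := minus_gen_span y; have [c cE] := simple_gen sS ey minus_gen.
have lt : (deg j < deg i)%N.
  rewrite ltnNge; apply/negP => le; apply: ey.
  by rewrite -bE -minus_gen_fix !scalerA eminus_off // scale0r.
exfalso; apply: minus_gen_neq0.
have ij : i != j by rewrite eq_sym.
by rewrite -minus_gen_fix -cE !scalerA eminus_off ?scale0r // ltnW.
Qed.

Lemma minus_gen_highest : highest_weight eminus deg i minus_gen.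
Proof.
split; [exact: minus_gen_fix | exact: minus_gen_neq0 | move=> j y ji].
by apply: minus_simple_weight; apply: contraTneq ji => ->; rewrite ltnn.
Qed.

Lemma minus_Delta_simple : simple (Delta eminus deg i).
Proof.
apply: simple_iso sS.
pose z : Delta eminus deg i := subquot_pi (trace_lideal eminus deg (deg i)) eminus_lideal.
apply: (@iso_cyclic _ _ _ minus_gen z); first exact: minus_gen_span.
  move=> y; have [x [[b xE] ->]] := subquot_piP y; exists b.
  by rewrite subquot_piZ; apply/subquot_pi_eq; rewrite xE subrr; exact: submodule0.
have J0 b : trace_ideal eminus deg (deg i) b -> b *: minus_gen = 0.
  by move=> Jb; exact: highest_weight_kill minus_gen_highest _ Jb minus_gen.
move=> b; rewrite subquot_piZ subquot_pi0.
change (b *: minus_gen = 0 <-> trace_ideal eminus deg (deg i) (b * eminus i)).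
split=> [b0|/J0]; last first.
  by rewrite -scalerA minus_gen_fix.
have [c Jc] := eminus_reduce i b.
have := J0 _ Jc; rewrite scalerBl -scalerA minus_gen_fix b0 sub0r => /eqP.
rewrite oppr_eq0 -[c *: eminus i]mulr_algl -scalerA minus_gen_fix.
move=> /eqP/kscale_eq0/(_ minus_gen_neq0) c0.
by move: Jc; rewrite c0 scale0r subr0.
Qed.

End MinusSimple.

(* T contracts the component of a in A^+ e_l (x) e_l A^- on the left by f. *)
Lemma split_contract_left (f : A -> k) l :
  (forall c x y, f (c *: x + y) = c * f x + f y) ->
  exists T : A -> B, [/\ forall a b, T (a + b) = T a + T b,
    forall a b, T (a * vsval b) = T a * b
    & forall r, split_sum Ap Am r -> T (msum e r) =
        \sum_(p <- r | p.1.1 == l) f (p.1.2 * e l) *: vsproj Am (e l * p.2)].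
Proof.
move=> flin; have [_ fD _ fZ] := functionalE flin.
have [||| T TE] := @split_component _ _ _ _ _ _ _ ry _ (fun x y => f x *: vsproj Am y) l.
- by move=> x y z; rewrite fD scalerDl.
- by move=> x y z; rewrite linearD scalerDr.
- by move=> c x y; rewrite fZ linearZ scalerA mulrC.
exists T; split=> // a b; have [r rr rE] := split_sum_exists ry a.
  have [s ss sE] := split_sum_exists ry b.
  by rewrite rE sE -msum_cat !TE ?split_sum_cat ?rr ?ss // big_cat.
have rb : split_sum Ap Am [seq (p.1.1, p.1.2, p.2 * vsval b) | p <- r].
  rewrite /split_sum all_map; apply/allP => p /(allP rr) /andP[p1 p2] /=.
  by rewrite p1 memvM ?subvsP.
rewrite rE -msum_mulr !TE // big_map mulr_suml /= big_seq_cond [RHS]big_seq_cond.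
apply: eq_bigr => p /andP[/(allP rr)/andP[p1 p2] _].
rewrite -scalerAl; congr (_ *: _); apply: subvs_inj.
by rewrite vsvalM !vsprojK ?mulrA // ?memvM ?subvsP // (reedy_memm ry).
Qed.

(** [A] is a finitely generated projective right [A^-]-module: [x] runs over bases of the [A^+ e_l],
    and [c] contracts the left tensor factor with the coordinates. *)
Lemma minus_dual_basis : exists (I : finType) (x : I -> A) (c : I -> A -> B),
  [/\ forall s a b, c s (a + b) = c s a + c s b,
      forall s a b, c s (a * vsval b) = c s a * b
    & forall a, a = \sum_s x s * vsval (c s a)].
Proof.
pose W l := (amulr (e l) @: Ap)%VS.
pose J := {l : 'I_n.+1 & 'I_(\dim (W l))}.
pose x (s : J) : A := (vbasis (W (tag s)))`_(tagged s).
have fT (s : J) := @split_contract_left (fun a => coord (vbasis (W (tag s))) (tagged s) a)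
  (tag s) (fun c a b => linearP (coord (vbasis (W (tag s))) (tagged s)) c a b).
exists J, x, (fun s => projT1 (cid (fT s))).
split=> [s|s|a]; try by have [] := projT2 (cid (fT s)).
have [r rr rE] := split_sum_exists ry a; rewrite {1}rE.
have E s : vsval (projT1 (cid (fT s)) a) = \sum_(p <- r | p.1.1 == tag s)
    coord (vbasis (W (tag s))) (tagged s) (p.1.2 * e (tag s)) *: (e (tag s) * p.2).
  have [_ _ TE] := projT2 (cid (fT s)).
  rewrite rE TE // linear_sum big_seq_cond [RHS]big_seq_cond.
  apply: eq_bigr => p /andP[/(allP rr)/andP[p1 p2] _].
  rewrite linearZ; congr (_ *: _); apply: vsprojK.
  by rewrite memvM // (reedy_memm ry).
under eq_bigr do rewrite E mulr_sumr.
transitivity (\sum_l \sum_(t < \dim (W l)) \sum_(p <- r | p.1.1 == l)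
    (vbasis (W l))`_t * (coord (vbasis (W l)) t (p.1.2 * e l) *: (e l * p.2))).
  rewrite /msum -(sum_fibers r (fun l p => p.1.2 * e l * p.2)).
  apply: eq_bigr => l _; rewrite exchange_big /=.
  rewrite big_seq_cond [RHS]big_seq_cond.
  apply: eq_bigr => p /andP[/(allP rr)/andP[p1 _] _].
  have pW : p.1.2 * e l \in W l by apply/memv_imgP; exists p.1.2; rewrite ?lfunE.
  under eq_bigr do rewrite -scalerAr scalerAl.
  by rewrite -mulr_suml -(coord_vbasis pW) -!mulrA (mulrA (e l)) (reedy_idem ry).
by rewrite sig_big_dep.
Qed.

(** The dual basis gives coordinates [comp s] from the induced module to [N], natural in [N], that
    recover each tensor. Injectivity and exactness in the middle are then checked coordinatewise. *)
Theorem minus_exact_induction : exact_induction Am.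
Proof.
have [I [x [c [cD cM cE]]]] := minus_dual_basis.
have rc s (N : lmodType B) :
    balanced (@right_mul k A Am) (fun a (y : N) => c s a *: y).
  split=> [a b y|a y z|a b y]; first by rewrite cD scalerDl.
    exact: scalerDr.
  by rewrite /right_mul cM scalerA.
pose comp s (N : lmodType B) : induct N -> N := tensor_lift (fun a (y : N) => c s a *: y).
have comp0 s (N : lmodType B) : comp s N 0 = 0 by exact: tensor_lift0.
have compD s (N : lmodType B) (t u : induct N) :
    comp s N (t + u) = comp s N t + comp s N u by exact: tensor_liftD.
have compT s (N : lmodType B) a (y : N) :
    comp s N (tens (@right_mul k A Am) a y) = c s a *: y.
  by apply: tensor_liftE; exact: rc.
have compE (N : lmodType B) (t : induct N) :
    t = \sum_s tens (@right_mul k A Am) (x s) (comp s N t).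
  have b := tens_balanced (@right_mul k A Am) N; have [bl br bb] := b.
  elim/tensor_ind: t => [a y||t u tE uE].
  - transitivity (\sum_s tens (@right_mul k A Am) (x s * vsval (c s a)) y).
      rewrite {1}(cE a); apply: (big_morph (fun a => tens (@right_mul k A Am) a y)).
        by move=> a1 a2; exact: bl.
      exact: balanced0l.
    by apply: eq_bigr => s _; rewrite compT -bb.
  - rewrite big1 // => s _; rewrite comp0.
    by apply: (addrI (tens (@right_mul k A Am) (x s) 0)); rewrite -br !addr0.
  - by rewrite {1}tE {1}uE -big_split; apply: eq_bigr => s _; rewrite compD br.
have compN s (M N : lmodType B) (f : {linear M -> N}) (t : induct M) :
    comp s N (induct_map f t) = f (comp s M t).
  have mapD := tensor_liftD (induct_map_balanced f).
  elim/tensor_ind: t => [a y||t u tE uE].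
  - by rewrite induct_mapE !compT linearZ.
  - by rewrite [induct_map f 0]tensor_lift0 ?comp0 ?linear0 //;
       exact: induct_map_balanced.
  - by rewrite [induct_map f _]mapD !compD tE uE linearD.
move=> N' N N'' f g [f_inj g_surj fg].
have inj0 (t : induct N') : induct_map f t = 0 -> t = 0.
  move=> ft; rewrite (compE _ t) big1 // => s _.
  have -> : comp s N' t = 0 by apply: f_inj; rewrite -compN ft comp0 linear0.
  have [_ br _] := tens_balanced (@right_mul k A Am) N'.
  by apply: (addrI (tens (@right_mul k A Am) (x s) 0)); rewrite -br !addr0.
split.
- move=> t u tu; apply/eqP; rewrite -subr_eq0; apply/eqP/inj0.
  by rewrite linearB tu subrr.
- elim/tensor_ind => [a y||t u [t' <-] [u' <-]].
  + by have [z <-] := g_surj y; exists (tens _ a z); exact: induct_mapE.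
  + by exists 0; rewrite linear0.
  + by exists (t' + u'); rewrite linearD.
- move=> t; split=> [gt|[u <-]]; last first.
    elim/tensor_ind: u => [a y||u v uE vE].
    + transitivity (induct_map g (tens (@right_mul k A Am) a (f y))).
        by congr induct_map; exact: induct_mapE.
      rewrite [LHS]induct_mapE (_ : g (f y) = 0); last by apply/fg; exists y.
      have [_ br _] := tens_balanced (@right_mul k A Am) N''.
      by apply: (addrI (tens (@right_mul k A Am) a 0)); rewrite -br !addr0.
    + by rewrite !linear0.
    + by rewrite !linearD uE vE addr0.
  have lift s : exists z, f z = comp s N t.
    by apply/fg; rewrite -compN gt comp0.
  exists (\sum_s tens _ (x s) (projT1 (cid (lift s)))).
  rewrite linear_sum [RHS]compE; apply: eq_bigr => s _.
  apply: etrans (induct_mapE _ _ _) _; congr (tens _ _ _).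
  exact: projT2 (cid (lift s)).
Qed.

(** The class of [e_i] and the tensor [1 (x) sg] generate the two modules; their annihilators are
    compared. *)
Lemma Delta_induct i (S : lmodType B) (q : {linear submod (lideal (eminus i)) -> S}) :
  simple S -> surj q -> lmod_iso (Delta e deg i) (induct S).
Proof.
move=> sS q_surj; set sg := minus_gen q.
have sg0 : sg <> 0 by exact: minus_gen_neq0.
have sgE : eminus i *: sg = sg by exact: minus_gen_fix.
have [bl br bb] := tens_balanced (@right_mul k A Am) S.
have tens0 a : tens (@right_mul k A Am) a (0 : S) = 0.
  by apply: (addrI (tens (@right_mul k A Am) a (0 : S))); rewrite -br !addr0.
pose y : induct S := tens (@right_mul k A Am) 1 sg.
have yE a : a *: y = tens (@right_mul k A Am) a sg.
  by apply: etrans (induct_scaleE _ _ _) _; rewrite mulr1.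
have e_lideal : lideal (e i) (e i : (A : nzRingType)^o) by exists 1; rewrite mul1r.
pose z : Delta e deg i := subquot_pi (trace_lideal e deg (deg i)) e_lideal.
have tens_e a : tens (@right_mul k A Am) a sg = tens (@right_mul k A Am) (a * e i) sg.
  by rewrite -{1}sgE -bb /right_mul vsval_eminus.
(* After straightening, [e_l y] with [deg l < deg i] lies in [A^-] and moves across the tensor sign,
   where it kills [S]. *)
have J0 a : trace_ideal e deg (deg i) a -> tens (@right_mul k A Am) a sg = 0.
  move=> /(trace_ideal_split ry)[r [/allP rr /allP dr ->]].
  rewrite /msum (big_morph (fun a => tens (@right_mul k A Am) a sg)
    (fun a b => bl a b sg) (balanced0l sg (tens_balanced (@right_mul k A Am) S))).
  rewrite big_seq big1 // => p pr; have /andP[p1 p2] := rr p pr.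
  have -> : p.1.2 * e p.1.1 * p.2 = right_mul p.1.2 (eminus p.1.1 * vsproj Am p.2).
    by rewrite /right_mul vsvalM vsval_eminus vsprojK // mulrA.
  rewrite bb -scalerA (minus_simple_weight sS q_surj) ?tens0 //.
  by apply: contraTneq (dr p pr) => ->; rewrite ltnn.
apply: (@iso_cyclic _ _ _ z y).
- move=> t; have [x [[b xE] ->]] := subquot_piP t; exists b.
  by rewrite subquot_piZ; apply/subquot_pi_eq; rewrite xE subrr; exact: submodule0.
- elim/tensor_ind => [a s||t u [a <-] [b <-]].
  + have [b <-] := minus_gen_span q_surj s; exists (a * vsval b).
    by rewrite yE -bb.
  + by exists 0; rewrite scale0r.
  + by exists (a + b); rewrite scalerDl.
move=> a; rewrite subquot_piZ subquot_pi0.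
change (trace_ideal e deg (deg i) (a * e i) <-> a *: y = 0).
rewrite yE tens_e; split=> [/J0//|t0].
have [x xA Jx] := plus_reduce ry i a.
have x0 : tens (@right_mul k A Am) (x * e i) sg = 0.
  by rewrite -t0 -[a](subrK x) mulrDl bl (J0 _ Jx) add0r.
suff xe0 : x * e i = 0 by move: Jx; rewrite mulrBl xe0 subr0.
apply/eqP/contraT => xe0.
(* A functional equal to [1] at [x e_i] induces a right [A^-]-linear map [T] sending [x e_i] to
   [e_i]; the resulting map to [S] sends [x e_i (x) sg] to [sg], which is nonzero. *)
have [|f [flin _ f1]] := @separating_functional _ _ 0%VS (x * e i).
  by rewrite memv0.
have [T [TD TM TE]] := split_contract_left i flin.
have bT : balanced (@right_mul k A Am) (fun a (s : S) => T a *: s).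
  split=> [b c s|b s t|b c s]; first by rewrite TD scalerDl.
    exact: scalerDr.
  by rewrite /right_mul TM scalerA.
have Tx : T (x * e i) = eminus i.
  have -> : x * e i = msum e [:: (i, x, 1)] by rewrite /msum big_seq1 mulr1.
  rewrite TE ?big_cons ?big_nil /= ?eqxx; last first.
    by rewrite /split_sum /= xA minus1.
  by rewrite f1 scale1r addr0 mulr1.
have := tensor_liftE (x * e i) sg bT; rewrite x0 tensor_lift0 // Tx sgE => /esym.
by move/sg0.
Qed.

End Minus.

Theorem theorem4p22 (k : fieldType) (A : falgType k) (n : nat)
  (e : 'I_n.+1 -> A) (deg : 'I_n.+1 -> nat) (Ap Am : {aspace A})
  (reedyA : reedy e deg Ap Am)
  (L : 'I_n.+1 -> lmodType A)
  (L_simple : forall i, reedy_simple e deg i (L i))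
  (S : 'I_n.+1 -> lmodType (subvs_of Am))
  (S_simple : forall i, reedy_minus_simple e i (S i)) :
  quasi_hereditary L (reedy_le deg) /\ exact_borel L (reedy_le deg) S.
Proof.
have herA := reedy_heredity reedyA; have herB := minus_heredity reedyA.
have L_highest i : simple (L i) /\ exists x : L i, highest_weight e deg i x.
  have [sL [q q_surj]] := L_simple i; split=> //.
  have e_lideal : lideal (e i) (e i : (A : nzRingType)^o) by exists 1; rewrite mul1r.
  pose g := q (quotmod_pi (lower_trace e deg i) (sub_elt e_lideal)).
  have gen x : exists a, a *: g = x.
    have [y <-] := q_surj x; rewrite -[y]quotmod_reprK.
    have [a aE] := submod_val_in (quotmod_repr y); exists a.
    by rewrite -!linearZ; congr (q (quotmod_pi _ _)); apply: val_inj; rewrite aE.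
  exists g; split.
  - rewrite -!linearZ; congr (q (quotmod_pi _ _)); apply: val_inj.
    by rewrite /= -[LHS]/(e i * e i) (reedy_idem reedyA).
  - move=> g0; have [[x x0] _] := sL; apply: x0.
    by have [a <-] := gen x; rewrite g0 scaler0.
  - move=> j x ji; have [a <-] := gen x.
    pose w : proj_mod e i := a *: sub_elt e_lideal.
    have -> : e j *: (a *: g) = q (quotmod_pi (lower_trace e deg i) (e j *: w)).
      by rewrite !linearZ.
    suff /quotmod_piE -> : lower_trace e deg i (e j *: w - 0) by rewrite !linear0.
    (* [e_j w] is the image of [e_j] under the homomorphism [u |-> u w] from [A e_j] to [A e_i],
       hence lies in a trace that is factored out. *)
    rewrite subr0 => U XU; apply: XU; exists j => //= V XV; apply: XV.
    have h_lin : linear (fun u : proj_mod e j => (val u : A) *: w).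
      by move=> b u v; rewrite scalerDl -scalerA.
    pose h : {linear proj_mod e j -> proj_mod e i} := HB.pack
      (fun u : proj_mod e j => (val u : A) *: w) (GRing.isLinear.Build A _ _ _ _ h_lin).
    have ej_lideal : lideal (e j) (e j : (A : nzRingType)^o) by exists 1; rewrite mul1r.
    by exists h, (sub_elt ej_lideal).
have S_highest i : simple (S i) /\ exists x : S i, highest_weight (eminus e Am) deg i x.
  have [sS [q q_surj]] := S_simple i; split=> //.
  by exists (minus_gen q); exact: (minus_gen_highest reedyA sS q_surj).
split; first exact: heredity_quasi_hereditary herA _ L_highest.
split.
- exact: minus1 reedyA.
- exact: heredity_quasi_hereditary herB _ S_highest.
- move=> i D stdD; have [sS [q q_surj]] := S_simple i.
  apply: simple_iso (iso_sym (standard_module_Delta herB S_highest stdD)) _.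
  exact: (minus_Delta_simple reedyA sS q_surj).
- exact: minus_exact_induction reedyA.
- move=> i D stdD; have [sS [q q_surj]] := S_simple i.
  apply: iso_trans (standard_module_Delta herA L_highest stdD) _.
  exact: (Delta_induct reedyA sS q_surj).
Qed.
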